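(* Assume that $\sigma(P)$ is known to the statistician. Let $(k_n)_n$ be a sparsity sequence with $k_n\in[1,n/2)$. (i) If $k_n\log^{1/2}(n)/n\gg1$, there exists no (sequence of) procedures (allowed to depend on $Y$ and $\sigma(P)$) that is AMO for $k_n$. (ii) If $k_n\log^{1/2}(n)/n=o(1)$, the scaling $(\widetilde\theta,\sigma(P))$ with $\widetilde\theta=Y_{(\lceil n/2\rceil)}$ is AMO for $k_n$, that is, the sequence of plug-in BH procedures $(\mathrm{BH}_\alpha(\widetilde\theta,\sigma(P)))_{\alpha\in(0,1)}$ is AMO for $k_n$.
   Context: Notation: $u_n\gg v_n$ means $v_n=o(u_n)$; $x\vee y=\max(x,y)$; $\overline\Phi$ is the upper tail function of $\mathcal N(0,1)$; $v_{(i)}$ is the $i$-th smallest entry of a vector $v$. Setting. One observes $Y=(Y_1,\dots,Y_n)$ with independent real coordinates, $Y_i\sim P_i$, and $P=\otimes_{i=1}^nP_i$ is the law of $Y$. $\mathcal P$ is the set of all such product distributions $P$ on $\mathbb R^n$ for which there exists $(\theta,\sigma)\in\mathbb R\times(0,\infty)$ with $|\{i: P_i=\mathcal N(\theta,\sigma^2)\}|>n/2$; this couple is unique and denoted $(\theta(P),\sigma(P))$. Let $\mathcal H_0(P)=\{i: P_i=\mathcal N(\theta(P),\sigma(P)^2)\}$ (true nulls), $\mathcal H_1(P)$ the complement of $\mathcal H_0(P)$ in $\{1,\dots,n\}$, $n_1(P)=|\mathcal H_1(P)|$. (All these objects depend on $n$.) Known variance: a multiple testing procedure may use $\sigma(P)$,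 i.e. it is a map $(y,s)\mapsto R(y,s)\subset\{1,\dots,n\}$, measurable in $y$, and under $P$ we write $R(Y)=R(Y,\sigma(P))$ for the set of rejected hypotheses. Set $$\mathrm{FDP}(P,R(Y))=\frac{|R(Y)\cap\mathcal H_0(P)|}{|R(Y)|\vee1},\quad \mathrm{FDR}(P,R)=\mathbb E_{Y\sim P}[\mathrm{FDP}(P,R(Y))],\quad \mathrm{TDP}(P,R(Y))=\frac{|R(Y)\cap\mathcal H_1(P)|}{n_1(P)\vee1}.$$ Plug-in BH. For $u\in\mathbb R$, $s>0$, let $p_i(u,s)=2\overline\Phi(|Y_i-u|/s)$, $T_\alpha(Y;u,s)=\max\{t\in[0,1]:\sum_{i=1}^n\mathbf 1\{p_i(u,s)\le t\}\ge nt/\alpha\}$ and $\mathrm{BH}_\alpha(u,s)=\mathrm{BH}_\alpha(Y;u,s)=\{i: p_i(u,s)\le T_\alpha(Y;u,s)\}$. The oracle BH procedure is $\mathrm{BH}^*_\alpha=\mathrm{BH}_\alpha(Y;\theta(P),\sigma(P))$. Risks: $\mathbf I(R,k)=\sup_{P\in\mathcal P,\,n_1(P)\le k}\mathrm{FDR}(P,R)$ and $\mathbf{II}(R,k,\alpha)=\sup_{P\in\mathcal P,\,n_1(P)\le k}\mathbb P_{Y\sim P}\big(\mathrm{TDP}(P,R)<\mathrm{TDP}(P,\mathrm{BH}^*_\alpha)\big)$. AMO. For a sparsity sequence $k_n\in[1,n/2)$, a sequence of procedures $R=(R_\alpha)_{\alpha\in(0,1)}$ (depending on $n$ and on $\alpha$)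 is AMO (asymptotically mimicking the oracle BH procedure) if there exists a positive sequence $\eta_n\to0$ such that both $$\limsup_n\sup_{\alpha\in(1/n,1/2)}\{\mathbf I(R_\alpha,k_n)-\alpha\}\le0,\qquad \lim_n\sup_{\alpha\in(1/n,1/2)}\mathbf{II}(R_\alpha,k_n,\alpha(1-\eta_n))=0 .$$ *)

(* Defs.v *)
From HB Require Import structures.
From mathcomp Require Import all_boot all_order all_algebra.
From mathcomp Require Import all_classical all_reals all_analysis.

Set Implicit Arguments.
Unset Strict Implicit.
Unset Printing Implicit Defensive.

Import Order.TTheory GRing.Theory Num.Theory.
Import numFieldNormedType.Exports.

Local Open Scope classical_set_scope.
Local Open Scope ring_scope.

Section pair_law.
Context d1 d2 (T1 : measurableType d1) (T2 : measurableType d2) (R : realType).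
Variables (p : probability T1 R) (q : probability T2 R).

Definition pair_law : set (T1 * T2) -> \bar R := (p \x q)%E.

HB.instance Definition _ := Measure.on pair_law.

Lemma pair_law_setT : pair_law setT = 1%E.
Proof.
rewrite /pair_law -setXTT product_measure1E//.
by rewrite -[RHS]mule1; congr (_ * _)%E; exact: probability_setT.
Qed.

HB.instance Definition _ :=
  Measure_isProbability.Build _ _ _ pair_law pair_law_setT.

End pair_law.

Section tuple_product.
Context {R : realType}.

Definition tuple_cons n (z : R * n.-tuple R) : n.+1.-tuple R :=
  [tuple of z.1 :: z.2].

Lemma measurable_tuple_cons n : measurable_fun setT (@tuple_cons n).
Proof.
by apply: measurable_cons; [exact: measurable_fst|exact: measurable_snd].
Qed.

HB.instance Definition _ n :=
  isMeasurableFun.Build _ _ _ _ (@tuple_cons n) (@measurable_tuple_cons n).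

(* The law of independent Y_i ~ P i, as a probability on n.-tuple R with its
   product sigma-algebra; [product_lawE] characterizes it on rectangles. *)
Fixpoint product_law n : ('I_n -> probability R R) -> probability (n.-tuple R) R :=
  match n with
  | 0 => fun _ => \d_ [tuple]
  | m.+1 => fun P =>
    distribution (pair_law (P ord0) (product_law (fun i => P (lift ord0 i))))
      (@tuple_cons m)
  end.

Lemma product_lawE n (P : 'I_n -> probability R R) (A : 'I_n -> set R) :
  (forall i, measurable (A i)) ->
  product_law P [set y | forall i, A i (tnth y i)] = (\prod_(i < n) P i (A i))%E.
Proof.
elim: n P A => [|n IH] P A mA.
  rewrite big_ord0 /= diracE mem_set//= => i; by case: i.
rewrite big_ord_recl -(IH _ (fun i => A (lift ord0 i)))//=.
rewrite /distribution /pushforward.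
have -> : @tuple_cons n @^-1` [set y | forall i, A i (tnth y i)] =
    A ord0 `*` [set y | forall i, A (lift ord0 i) (tnth y i)].
  apply/seteqP; split=> [[x y] /= H|[x y] /= [H0 H] i].
    split=> [|i]; first by have := H ord0; rewrite tnth0.
    by have := H (lift ord0 i); rewrite tnthS.
  by case: (unliftP ord0 i) => [j ->|->]; rewrite ?tnthS ?tnth0.
rewrite /pair_law product_measure1E//.
have -> : [set y : n.-tuple R | forall i, A (lift ord0 i) (tnth y i)] =
    \bigcap_(i in [set: 'I_n]) ((@tnth n R)^~ i @^-1` A (lift ord0 i)).
  by apply/seteqP; split=> y /= H i; [move=> _|]; exact: H.
apply: fin_bigcap_measurable => // i _.
by rewrite -[X in measurable X]setTI; exact: measurable_tnth.
Qed.

End tuple_product.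

Section model.
Context {R : realType}.

(* A product distribution on R^n is represented by its marginals P_i, which it
   determines; the law of Y itself is [product_law P]. *)
Notation model n := ('I_n -> probability R R).

(* P i = N(theta, sigma^2): equality on measurable sets, since a measure is
   unconstrained elsewhere. *)
Definition gaussian_at n (P : model n) (theta sigma : R) (i : 'I_n) : Prop :=
  forall A : set R, measurable A -> P i A = normal_prob theta sigma A.

Definition null_parameter n (P : model n) (ts : R * R) : Prop :=
  0 < ts.2 /\ (n < 2 * #|[set i | `[< gaussian_at P ts.1 ts.2 i >]]%SET|)%N.

Definition in_model n (P : model n) : Prop := exists ts, null_parameter P ts.

(* The null parameter is unique when it exists; the default (0, 1) is reached
   only outside [in_model]. *)
Definition theta n (P : model n) : R := (xget (0, 1) (null_parameter P)).1.
Definition sigma n (P : model n) : R := (xget (0, 1) (null_parameter P)).2.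

Definition H0 n (P : model n) : {set 'I_n} :=
  [set i | `[< gaussian_at P (theta P) (sigma P) i >]]%SET.
Definition H1 n (P : model n) : {set 'I_n} := (~: H0 P)%SET.
Definition n1 n (P : model n) : nat := #|H1 P|.

(* A procedure maps the data y and the known standard deviation s to the set of
   rejected hypotheses. *)
Definition procedure n := n.-tuple R -> R -> {set 'I_n}.

(* {set 'I_n} is finite, so measurability in y reduces to level sets. *)
Definition measurable_procedure n (Rej : procedure n) : Prop :=
  forall (s : R) (S : {set 'I_n}), 0 < s ->
    measurable [set y : n.-tuple R | Rej y s = S].

Definition FDP n (P : model n) (S : {set 'I_n}) : R :=
  #|(S :&: H0 P)%SET|%:R / (maxn #|S| 1)%:R.

Definition FDR n (P : model n) (Rej : procedure n) : \bar R :=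
  'E_(product_law P)[fun y => FDP P (Rej y (sigma P))]%E.

Definition TDP n (P : model n) (S : {set 'I_n}) : R :=
  #|(S :&: H1 P)%SET|%:R / (maxn (n1 P) 1)%:R.

Definition upper_tail (x : R) : R := fine (normal_prob (0 : R) 1 `]x, +oo[).

Definition pvalue n (y : n.-tuple R) (u s : R) (i : 'I_n) : R :=
  2 * upper_tail (`|tnth y i - u| / s).

Definition BH_set n (alpha : R) (y : n.-tuple R) (u s : R) : set R :=
  [set t | 0 <= t <= 1 /\
    n%:R * t / alpha <= #|[set i | pvalue y u s i <= t]%SET|%:R].

(* For alpha > 0 this supremum is a maximum: see [BH_threshold_max]. *)
Definition BH_threshold n (alpha : R) (y : n.-tuple R) (u s : R) : R :=
  sup (BH_set alpha y u s).

Lemma BH_threshold_max n (alpha : R) (y : n.-tuple R) (u s : R) : 0 < alpha ->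
  BH_set alpha y u s (BH_threshold alpha y u s) /\
  ubound (BH_set alpha y u s) (BH_threshold alpha y u s).
Proof.
move=> a0; set A := BH_set _ _ _ _.
have A0 : A 0 by split; rewrite ?lexx ?ler01// mulr0 mul0r.
have ub1 : ubound A 1 by move=> t [/andP[]].
have hsA : has_sup A by split; [exists 0 | exists 1].
have ubs : ubound A (sup A) by apply: sup_upper_bound.
split=> //; split.
  by rewrite ubs//= ge_sup//; exists 0.
case: n => [|n] in y A A0 ub1 hsA ubs *; first by rewrite !mul0r.
rewrite ler_pdivrMr// -ler_pdivlMl ?ltr0n// ge_sup//; first by exists 0.
move=> t At; have [_] := At.
rewrite ler_pdivrMr// -ler_pdivlMl ?ltr0n// => /le_trans; apply.
rewrite ler_pM2l ?invr_gt0 ?ltr0n// ler_pM2r// ler_nat subset_leq_card//.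
by apply/fintype.subsetP => i; rewrite !inE => /le_trans; apply; exact: ubs.
Qed.

Definition BH n (alpha : R) (y : n.-tuple R) (u s : R) : {set 'I_n} :=
  [set i | pvalue y u s i <= BH_threshold alpha y u s]%SET.

Definition oracle_BH n (P : model n) (alpha : R) (y : n.-tuple R) : {set 'I_n} :=
  BH alpha y (theta P) (sigma P).

Definition sparse_model n (k : R) : set (model n) :=
  [set P | in_model P /\ (n1 P)%:R <= k].

Definition risk_I n (Rej : procedure n) (k : R) : \bar R :=
  ereal_sup [set FDR P Rej | P in sparse_model k].

Definition risk_II n (Rej : procedure n) (k alpha : R) : \bar R :=
  ereal_sup [set product_law P
      [set y | TDP P (Rej y (sigma P)) < TDP P (oracle_BH P alpha y)]
    | P in sparse_model k].

Definition level_range n : set R := [set alpha | n%:R^-1 < alpha < 2^-1].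

Definition AMO (Rej : forall n, R -> procedure n) (k : nat -> R) : Prop :=
  (forall n alpha, 0 < alpha < 1 -> measurable_procedure (Rej n alpha)) /\
  exists2 eta : nat -> R, (forall n, 0 < eta n) /\ eta @ \oo --> 0 &
    (limn_esup (fun n => ereal_sup
       [set risk_I (Rej n alpha) (k n) - alpha%:E
       | alpha in level_range n]) <= 0)%E /\
    (fun n => ereal_sup
       [set risk_II (Rej n alpha) (k n) (alpha * (1 - eta n))
       | alpha in level_range n]) @ \oo --> 0%E.

(* Valid for 1 <= m <= n (1-based rank). *)
Definition order_stat n (y : n.-tuple R) (m : nat) : R :=
  nth 0 (sort <=%R y) m.-1.

(* [uphalf n] is the ceiling of n / 2. *)
Definition median n (y : n.-tuple R) : R := order_stat y (uphalf n).

End model.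

(* Main.v *)
From HB Require Import structures.
Require Import Defs.
From mathcomp Require Import all_boot all_order all_algebra.
From mathcomp Require Import all_classical all_reals all_analysis.
From mathcomp Require Import measurable_realfun.
From mathcomp Require Import ring lra.

Set Implicit Arguments.
Unset Strict Implicit.
Unset Printing Implicit Defensive.

Import Order.TTheory GRing.Theory Num.Theory.
Import numFieldNormedType.Exports.

Local Open Scope classical_set_scope.
Local Open Scope ring_scope.

(** Translating the centre of a Gaussian tail by [d] standard deviations
    multiplies [upper_tail x] by about [expR (d * x)].  For [alpha > n^-1] the
    p-values that decide the Benjamini-Hochberg procedure are at least of order
    [n^-2], hence they sit at [x] of order [sqrt (ln n)]: the oracle can be
    imitated as soon as the centre of the null is known up to
    [o (1 / sqrt (ln n))] standard deviations, and not otherwise.  As [k]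
    arbitrary coordinates out of [n] can displace the apparent centre by about
    [k / n], the boundary lies at [k * sqrt (ln n) / n] of order one.

    Sparse regime.  By a Chernoff bound the median is within [d] standard
    deviations of the centre, [d] being of order [k / n + n ^ (-1/4)], outside
    an event of vanishing probability ([median_deviation]); then
    [d * sqrt (ln n)] vanishes and all relevant tails are preserved up to a
    factor [tail_ratio n d] tending to 1 ([upper_tail_ratio]).
    On the good event the oracle at a slightly smaller level rejects less than
    the plug-in procedure ([BH_oracle_sub]), which settles the true discovery
    proportion.  The median depends on all the data, so that the classical
    leave-one-out proof of false discovery rate control does not apply as such.
    It is rescued as follows: freeze every coordinate but one null coordinate
    [i]; as long as [i] is rejected and stays on the same side of the median,
    neither the median nor the set of rejections depends on its value
    ([order_stat_update_beyond], [BH_stable]).  Hence, on each side, [i]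
    contributes to the false discovery proportion a constant [1 / r] times the
    probability of a Gaussian tail of nominal size [alpha * r / (2 * n)], that
    is at most [tail_ratio n d * alpha / (2 * n)] ([integral_fdp_share]).
    Summing over the two sides and the null coordinates gives
    [alpha * tail_ratio n d] ([FDR_plugin_le]).

    Dense regime.  Let [m = k / (32 * n)] and let [f0], [fm] be the densities
    of [N(0, 1)] and [N(m, 1)].  Since [f0 + (fm - f0)^+ = fm + (f0 - fm)^+],
    one and the same law is a contamination of [N(0, 1)] by a law living above
    [m / 2] and a contamination of [N(m, 1)] by a law living below [m / 2]
    ([mixture_law_right], [mixture_law_left]), with a proportion of
    alternatives at most [m / 2].  The data do not tell the two readings apart,
    and every rejection is false in one of them, so the two false discovery
    proportions add up to at least 1 whenever something is rejected.  If both
    false discovery rates are small, rejections are therefore rare.  However,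
    [m * sqrt (ln n)] being large, the tail of [N(m, 1)] is much heavier than
    that of [N(0, 1)] at the Bonferroni threshold of the latter, so that the
    oracle of the first reading nearly always finds an alternative and a
    procedure that is at least as powerful must reject ([mimicking_tradeoff]).
*)

(** * Gaussian tails *)
Section gauss.
Context {R : realType}.
Implicit Types a x y z m s d t L M : R.
Notation mu := (@lebesgue_measure R).

Lemma measurable_EFin_normal_pdf m s (D : set R) :
  measurable_fun D (EFin \o normal_pdf m s).
Proof.
by apply/measurable_EFinP; apply: measurable_funTS; exact: measurable_normal_pdf.
Qed.

Lemma normal_pdf_affine m s x : 0 < s ->
  normal_pdf m s x = normal_pdf 0 1 ((x - m) / s) * s^-1.
Proof.
move=> s0; rewrite !normal_pdfE ?oner_neq0 ?gt_eqF//.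
rewrite /normal_peak /normal_fun subr0 expr1n.
rewrite [RHS]mulrAC; congr (_ * expR _); last first.
  by field; rewrite gt_eqF.
rewrite -mulrnAr sqrtrM ?sqr_ge0// sqrtr_sqr gtr0_norm// invfM mulrC.
by rewrite mul1r.
Qed.

Lemma upper_tailE x : normal_prob 0 1 `]x, +oo[ = (upper_tail x)%:E.
Proof. by rewrite /upper_tail fineK// fin_num_measure. Qed.

Lemma normal_prob_gt m s x : 0 < s ->
  normal_prob m s `]x, +oo[ = (upper_tail ((x - m) / s))%:E.
Proof.
move=> s0; rewrite -upper_tailE /normal_prob.
rewrite !integral_itv_obnd_cbnd.
- pose F (y : R^o) : R^o := (y - m) / s.
  have F'E : F^`()%classic = cst s^-1.
    apply/funext => y; rewrite /F derive1E deriveM// deriveD// derive_cst scaler0.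
    by rewrite add0r derive_id derive_cst addr0 scaler1.
  rewrite -[in RHS]/(F x) (@increasing_ge0_integration_by_substitutiony _ F); last first.
  + by move=> *; exact: normal_pdf_ge0.
  + by apply: continuous_subspaceT; apply: continuous_normal_pdf; rewrite oner_neq0.
  + apply/gt0_cvgMly; rewrite ?invr_gt0//; exact: cvg_addrr.
  + split; first by move=> y _; apply: derivableM => //; apply: derivableB.
    by apply: cvg_at_right_filter; apply: cvgMl; apply: (@cvgB _ R^o) => //; exact: cvg_cst.
  + by rewrite F'E; exact: is_cvg_cst.
  + by rewrite F'E; exact: is_cvg_cst.
  + by rewrite F'E => ? _; exact: cvg_cst.
  + by move=> y z _ _ yz; rewrite /F ltr_pM2r ?invr_gt0// ltrD2r.
  apply: eq_integral => y _; rewrite F'E /= normal_pdf_affine//.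
- by exact: measurable_EFin_normal_pdf.
- by exact: measurable_EFin_normal_pdf.
Qed.

Lemma normal_pdfN x : normal_pdf 0 1 (- x) = normal_pdf 0 1 x :> R.
Proof. by rewrite !normal_pdfE ?oner_neq0// /normal_fun !subr0 sqrrN. Qed.

Lemma normal_prob01_le x : normal_prob 0 1 `]-oo, (- x)] = (upper_tail x)%:E.
Proof.
rewrite -upper_tailE /normal_prob integral_itv_obnd_cbnd.
  rewrite ge0_integration_by_substitutionNy.
  - by apply: eq_integral => y _; rewrite /= normal_pdfN.
  - by apply: continuous_subspaceT; apply: continuous_normal_pdf; rewrite oner_neq0.
  - by move=> *; exact: normal_pdf_ge0.
by exact: measurable_EFin_normal_pdf.
Qed.

Lemma upper_tailN x : upper_tail (- x) = 1 - upper_tail x.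
Proof.
apply: EFin_inj; rewrite EFinB -normal_prob01_le -upper_tailE -probability_setC//.
by rewrite opprK setCitvr.
Qed.

Lemma normal_prob_le m s x : 0 < s ->
  normal_prob m s `]-oo, x] = (upper_tail ((m - x) / s))%:E.
Proof.
move=> s0; rewrite -setCitvr probability_setC// [X in (_ - X)%E](normal_prob_gt _ _ s0).
by rewrite -EFinB -upper_tailN -mulNr opprB.
Qed.

Lemma normal_prob_lt m s x : 0 < s ->
  normal_prob m s `]-oo, x[ = (upper_tail ((m - x) / s))%:E.
Proof.
move=> s0; rewrite -normal_prob_le// /normal_prob integral_itv_bndo_bndc//.
exact: measurable_EFin_normal_pdf.
Qed.

Lemma normal_prob_ge m s x : 0 < s ->
  normal_prob m s `[x, +oo[ = (upper_tail ((x - m) / s))%:E.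
Proof.
move=> s0; rewrite -normal_prob_gt// /normal_prob integral_itv_obnd_cbnd//.
exact: measurable_EFin_normal_pdf.
Qed.

Lemma upper_tail_ge0 x : 0 <= upper_tail x.
Proof. by rewrite fine_ge0. Qed.

Lemma upper_tail_le1 x : upper_tail x <= 1.
Proof. by rewrite -lee_fin -upper_tailE probability_le1. Qed.

Lemma upper_tail0 : upper_tail (0 : R) = 2^-1.
Proof. by have := upper_tailN 0; rewrite oppr0; lra. Qed.

Lemma normal_prob_oc m s x y : 0 < s -> x <= y ->
  normal_prob m s `]x, y] =
  (upper_tail ((x - m) / s) - upper_tail ((y - m) / s))%:E.
Proof.
move=> s0 xy; rewrite EFinB -!normal_prob_gt//.
have -> : `]x, +oo[%classic = `]x, y] `|` `]y, +oo[ :> set R.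
  by rewrite -itv_bndbnd_setU// bnd_simp.
rewrite measureU//= ?addeK ?fin_num_measure//.
apply/seteqP; split => // t [] /=; rewrite !in_itv/= => /andP[_ h]; rewrite andbT => /(le_lt_trans h).
by rewrite ltxx.
Qed.

Lemma upper_tailB x y : x <= y ->
  (upper_tail x - upper_tail y)%:E =
  (\int[mu]_(t in `]x, y]) (normal_pdf 0 1 t)%:E)%E.
Proof. by move=> xy; have := normal_prob_oc 0 ltr01 xy; rewrite !subr0 !divr1 => <-. Qed.

Lemma le_upper_tail x y : x <= y -> upper_tail y <= upper_tail x.
Proof.
move=> xy; rewrite -subr_ge0 -lee_fin upper_tailB//.
by apply: integral_ge0 => t _; rewrite lee_fin normal_pdf_ge0.
Qed.

Lemma normal_peak1_le : normal_peak 1 <= 2^-1 :> R.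
Proof.
have h : 2 ^+ 2 <= (1 ^+ 2 * pi *+ 2 : R).
  by rewrite expr1n mul1r; have := pi_ge2 R; rewrite mulr2n; lra.
have h2 : (2 : R) <= Num.sqrt (1 ^+ 2 * pi *+ 2).
  by rewrite -(@ger0_norm _ 2)// -sqrtr_sqr ler_wsqrtr.
by rewrite /normal_peak lef_pV2 ?posrE// (lt_le_trans _ h2).
Qed.

Lemma upper_tailB_le x y : x <= y -> upper_tail x - upper_tail y <= (y - x) / 2.
Proof.
move=> xy; rewrite -lee_fin upper_tailB//.
apply: (@le_trans _ _ (\int[mu]_(t in `]x, y]) (2^-1)%:E)%E).
  apply: ge0_le_integral => //=.
  - by move=> t _; rewrite lee_fin normal_pdf_ge0.
  - by exact: measurable_EFin_normal_pdf.
  - move=> t _; rewrite lee_fin (le_trans (normal_pdf_ub _ _ _)) ?oner_neq0//.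
    exact: normal_peak1_le.
rewrite integral_cst//= lebesgue_measure_itv/= lte_fin; case: ifP => [_|].
  by rewrite -EFinB -EFinM lee_fin mulrC.
by rewrite mule0 lee_fin mulr_ge0// subr_ge0.
Qed.

Lemma normal_pdf01_anti x y : 0 <= x <= y -> normal_pdf 0 1 y <= normal_pdf 0 1 x :> R.
Proof.
move=> /andP[x0 xy]; rewrite !normal_pdfE ?oner_neq0// ler_wpM2l ?normal_peak_ge0//.
rewrite /normal_fun !subr0 expr1n ler_expR.
rewrite ler_pM2r ?invr_gt0// lerN2 ler_pXn2r ?nnegrE//.
exact: le_trans xy.
Qed.

Lemma normal_pdf01_norm x : normal_pdf 0 1 `|x| = normal_pdf 0 1 x :> R.
Proof. by rewrite !normal_pdfE ?oner_neq0// /normal_fun !subr0 real_normK ?num_real. Qed.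

Lemma normal_pdf01_gt0 x : 0 < normal_pdf 0 1 x :> R.
Proof.
by rewrite normal_pdfE ?oner_neq0// mulr_gt0 ?expR_gt0// normal_peak_gt0// oner_neq0.
Qed.

(** The density is at least its value at [M] on the whole interval; this gives
    strict monotonicity of the tail, and a linear rate of decrease near 0.
*)
Lemma upper_tailB_ge x y M : x <= y -> `|x| <= M -> `|y| <= M ->
  (y - x) * normal_pdf 0 1 M <= upper_tail x - upper_tail y.
Proof.
move=> xy xM yM; rewrite -lee_fin upper_tailB//.
apply: (@le_trans _ _ (\int[mu]_(t in `]x, y]) (normal_pdf 0 1 M)%:E)%E).
  rewrite integral_cst//= lebesgue_measure_itv/= lte_fin; case: ifP => [_|].
    by rewrite -EFinB -EFinM lee_fin mulrC.
  move=> /negbT; rewrite -leNgt => yx; have -> : y = x by apply/eqP; rewrite eq_le yx xy.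
  by rewrite subrr mul0r mule0.
apply: ge0_le_integral => //=.
- by move=> t _; rewrite lee_fin normal_pdf_ge0.
- by exact: measurable_EFin_normal_pdf.
- move=> t; rewrite in_itv/= lee_fin => /andP[xt ty].
  rewrite -(normal_pdf01_norm t); apply: normal_pdf01_anti; rewrite normr_ge0/=.
  by move: xM yM; rewrite !ler_norml => /andP[? ?] /andP[? ?]; apply/andP; split; lra.
Qed.

Lemma lt_upper_tail x y : x < y -> upper_tail y < upper_tail x.
Proof.
move=> xy; rewrite -subr_gt0; pose M := Num.max `|x| `|y|.
apply: (@lt_le_trans _ _ ((y - x) * normal_pdf 0 1 M)).
  by rewrite mulr_gt0 ?normal_pdf01_gt0// subr_gt0.
by apply: upper_tailB_ge; [exact: ltW|rewrite le_max lexx|rewrite le_max lexx orbT].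
Qed.

Lemma upper_tail_leE x y : (upper_tail x <= upper_tail y) = (y <= x).
Proof.
apply/idP/idP; last exact: le_upper_tail.
by apply: contraTT; rewrite -!ltNge; exact: lt_upper_tail.
Qed.

Lemma upper_tail_inj : injective (@upper_tail R).
Proof.
by move=> x y xy; apply: le_anti; rewrite -(upper_tail_leE y) -(upper_tail_leE x) xy lexx.
Qed.

Lemma upper_tail_gt0 x : 0 < upper_tail x.
Proof. by rewrite (le_lt_trans (upper_tail_ge0 (x + 1)))// lt_upper_tail// ltrDl. Qed.

(** The likelihood ratio of [N(m, 1)] to [N(0, 1)]; all comparisons between
    shifted tails come from it.
*)
Lemma normal_pdf_shift m x :
  normal_pdf m 1 x = normal_pdf 0 1 x * expR (m * x - m ^+ 2 / 2) :> R.
Proof.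
rewrite !normal_pdfE ?oner_neq0// -mulrA; congr (_ * _).
by rewrite /normal_fun -expRD; congr expR; field.
Qed.

(** Beyond [x] the likelihood ratio is at least its value at [x].
*)
Lemma upper_tail_shift_ge m x : 0 <= m ->
  expR (m * x - m ^+ 2 / 2) * upper_tail x <= upper_tail (x - m).
Proof.
move=> m0; rewrite -lee_fin EFinM -upper_tailE -[x - m]divr1 -normal_prob_gt//.
rewrite /normal_prob -ge0_integralZl//=; last 2 first.
- exact: measurable_EFin_normal_pdf.
- by move=> t _; rewrite lee_fin normal_pdf_ge0.
apply: ge0_le_integral => //=.
- by move=> t _; rewrite -EFinM lee_fin mulr_ge0 ?normal_pdf_ge0 ?expR_ge0.
- by apply: measurable_funeM; exact: measurable_EFin_normal_pdf.
- exact: measurable_EFin_normal_pdf.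
- move=> t; rewrite in_itv/= andbT => xt.
  rewrite (normal_pdf_shift m) -EFinM lee_fin mulrC ler_wpM2l ?normal_pdf_ge0//.
  by rewrite ler_expR lerD2r ler_wpM2l// ltW.
Qed.

(** The likelihood ratio is unbounded on the right, so the tail is cut at [L]:
    between [z] and [L] the ratio is at most [expR (d * L)], and beyond [L] the
    shifted tail is kept as it is.
*)
Lemma upper_tail_shift_le d z L : 0 <= d -> 0 <= L ->
  upper_tail (z - d) <= expR (d * L) * upper_tail z + upper_tail (L - d).
Proof.
move=> d0 L0; have [Lz|zL] := leP L z.
  apply: (@le_trans _ _ (upper_tail (L - d))); first by rewrite le_upper_tail// lerB.
  by rewrite lerDr mulr_ge0 ?expR_ge0 ?upper_tail_ge0.
rewrite -lerBlDr.
apply: (@le_trans _ _ (expR (d * L) * (upper_tail z - upper_tail L))); last first.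
  by rewrite ler_wpM2l ?expR_ge0// lerBlDr lerDl upper_tail_ge0.
have := normal_prob_oc d ltr01 (ltW zL); rewrite !divr1 => h.
rewrite -lee_fin -h EFinM upper_tailB ?(ltW zL)// /normal_prob -ge0_integralZl//=; last 2 first.
- exact: measurable_EFin_normal_pdf.
- by move=> t _; rewrite lee_fin normal_pdf_ge0.
apply: ge0_le_integral => //=.
- by move=> t _; rewrite lee_fin normal_pdf_ge0.
- exact: measurable_EFin_normal_pdf.
- by apply: measurable_funeM; exact: measurable_EFin_normal_pdf.
- move=> t; rewrite in_itv/= => /andP[zt tL].
  rewrite (normal_pdf_shift d) -EFinM lee_fin mulrC ler_wpM2r ?normal_pdf_ge0//.
  rewrite ler_expR lerBlDr (le_trans (ler_wpM2l d0 tL))// lerDl.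
  by rewrite divr_ge0 ?sqr_ge0.
Qed.

(** This is [upper_tail_shift_ge] with a shift of [x] itself, which brings the
    tail to [upper_tail 0].
*)
Lemma upper_tail_le_exp x : 0 <= x -> upper_tail x <= expR (- (x ^+ 2 / 2)).
Proof.
move=> x0; have := upper_tail_shift_ge x x0; rewrite subrr upper_tail0.
have -> : x * x - x ^+ 2 / 2 = x ^+ 2 / 2 by field.
move=> h; rewrite expRN -[leRHS]mul1r ler_pdivlMr ?expR_gt0// mulrC (le_trans h)//.
by rewrite invf_le1// ler1n.
Qed.

Lemma upper_tail_ge_pdf x : 0 <= x -> normal_pdf 0 1 (x + 1) <= upper_tail x.
Proof.
move=> x0; have := @upper_tailB_ge x (x + 1) (x + 1).
rewrite lerDl ler01 !ger0_norm ?addr_ge0// lexx lerDl ler01 => /(_ isT isT isT).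
rewrite [x + 1 - x]addrAC subrr add0r mul1r => /le_trans; apply.
by rewrite lerBlDr lerDl upper_tail_ge0.
Qed.

Lemma continuous_upper_tail : continuous (@upper_tail R).
Proof.
move=> x; apply/cvgrPdist_le => e e0; near=> y.
have h : `|x - y| <= e by near: y; apply: cvgr_dist_le.
rewrite (le_trans _ h)//.
have key (a b : R) : a <= b -> `|upper_tail a - upper_tail b| <= `|a - b|.
  move=> ab; rewrite ger0_norm ?subr_ge0 ?le_upper_tail//.
  by rewrite ler0_norm ?subr_le0//; have := upper_tailB_le ab; lra.
have [xy|/ltW yx] := leP x y; first exact: key.
by rewrite distrC [leRHS]distrC key.
Unshelve. all: by end_near. Qed.

Lemma upper_tail_quantile a : 0 < a <= 2^-1 -> exists2 z, 0 <= z & upper_tail z = a.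
Proof.
move=> /andP[a0 a1].
have M0 : 0 <= 2 / a by rewrite divr_ge0// ltW.
have hM : upper_tail (2 / a) <= a.
  apply: (le_trans (upper_tail_le_exp M0)).
  rewrite expRN -[leRHS]invrK lef_pV2 ?posrE ?invr_gt0 ?expR_gt0//.
  apply: le_trans (expR_ge1Dx _); apply: (@le_trans _ _ (2 * (a^-1 * a^-1))).
    rewrite mulrA -[leLHS]mul1r ler_wpM2r ?invr_ge0 ?(ltW a0)//.
    by rewrite ler_pdivlMr//; lra.
  have -> : (2 / a) ^+ 2 / 2 = 2 * (a^-1 * a^-1) by field; rewrite gt_eqF.
  by rewrite lerDr.
have [||c] := @IVT R upper_tail 0 (2 / a) a M0.
- by apply: continuous_subspaceT; exact: continuous_upper_tail.
- by rewrite upper_tail0 ge_min le_max hM a1 orbT.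
- by rewrite in_itv/= => /andP[c0 _] <-; exists c.
Qed.

(** Cutting at [L = 4 * sqrt (ln n) + 1] makes the remainder at most [n ^- 8],
    negligible with respect to tails of size [n ^- 2].
*)
Lemma upper_tail_ratio (n : nat) d z : (1 < n)%N -> 0 <= d <= 1 ->
  (4 * n%:R ^+ 2)^-1 <= upper_tail z ->
  upper_tail (z - d) <=
    (expR (d * (4 * Num.sqrt (ln n%:R) + 1)) + n%:R^-1) * upper_tail z.
Proof.
move=> n1 /andP[d0 d1] hz; set L := 4 * _ + 1.
have n0 : 0 < n%:R :> R by rewrite ltr0n (ltn_trans _ n1).
have s0 : 0 <= Num.sqrt (ln (n%:R : R)) by exact: sqrtr_ge0.
have L0 : 0 <= L by rewrite /L; lra.
apply: (le_trans (upper_tail_shift_le z d0 L0)).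
rewrite mulrDl lerD2l.
apply: (@le_trans _ _ (upper_tail (4 * Num.sqrt (ln (n%:R : R))))).
  by rewrite le_upper_tail// /L; lra.
apply: (le_trans (upper_tail_le_exp _)); first by rewrite mulr_ge0.
rewrite exprMn sqr_sqrtr ?ln_ge0 ?ler1n ?(ltn_trans _ n1)//.
have -> : 4 ^+ 2 * ln n%:R / 2 = 8%:R * ln (n%:R : R) by field.
rewrite expRN expRM_natl lnK ?posrE//.
apply: (@le_trans _ _ (n%:R^-1 * (4 * n%:R ^+ 2)^-1)); last first.
  by rewrite ler_wpM2l ?invr_ge0 ?(ltW n0).
rewrite -invfM lef_pV2 ?posrE ?mulr_gt0 ?exprn_gt0//.
have -> : n%:R ^+ 8 = (n%:R * (n%:R ^+ 5 * n%:R ^+ 2)) :> R by ring.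
rewrite ler_wpM2l ?(ltW n0)// ler_wpM2r ?exprn_ge0 ?(ltW n0)//.
apply: (@le_trans _ _ (2%:R ^+ 5)); first by rewrite -natrX ler_nat.
by rewrite ler_pXn2r ?nnegrE ?ler_nat ?(ltW n0).
Qed.

Lemma normal_prob_inj m s m' s' : 0 < s -> 0 < s' ->
  (forall A, measurable A -> normal_prob m s A = normal_prob m' s' A) ->
  m = m' /\ s = s'.
Proof.
move=> s0 s'0 h.
have key x : (x - m) / s = (x - m') / s'.
  apply: upper_tail_inj; apply: EFin_inj.
  rewrite -(normal_prob_gt m x s0) -(normal_prob_gt m' x s'0).
  exact: h.
have mm : m = m'.
  have := key m; rewrite subrr mul0r => /esym/eqP.
  by rewrite mulf_eq0 invr_eq0 (gt_eqF s'0) orbF subr_eq0 => /eqP.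
split=> //; have := key (m + 1); rewrite -mm [m + 1 - m]addrAC subrr add0r !mul1r.
exact: invr_inj.
Qed.

End gauss.

(** [normal_prob] as a probability on the carrier used for the marginals of a
    model.
*)
Definition normal_law {R : realType} (m s : R) : set R -> \bar R := normal_prob m s.

Section normal_law_probability.
Context {R : realType}.
Variables m s : R.

Let normal_law0 : normal_law m s set0 = 0%E.
Proof. exact: (@measure0 _ _ _ (normal_prob m s)). Qed.

Let normal_law_ge0 A : (0 <= normal_law m s A)%E.
Proof. exact: (@measure_ge0 _ _ _ (normal_prob m s)). Qed.

Let normal_law_sigma_additive : semi_sigma_additive (normal_law m s).
Proof. exact: (@measure_semi_sigma_additive _ _ _ (normal_prob m s)). Qed.

HB.instance Definition _ := isMeasure.Build _ _ _ (normal_law m s)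
  normal_law0 normal_law_ge0 normal_law_sigma_additive.

Let normal_law_setT : normal_law m s setT = 1%E.
Proof. exact: (@probability_setT _ _ _ (normal_prob m s)). Qed.

HB.instance Definition _ :=
  Measure_isProbability.Build _ _ _ (normal_law m s) normal_law_setT.

End normal_law_probability.

(** * Integration against product laws *)
Section product_integrals.
Context {R : realType}.
Local Open Scope ereal_scope.

Lemma integral_cst_probability d (T : measurableType d) (P : probability T R) (c : \bar R) :
  \int[P]_x c = c.
Proof. by rewrite integral_cst// [X in _ * X](@probability_setT _ _ _ P) mule1. Qed.

Lemma measurable_tuple_cons_pair n (G : n.+1.-tuple R -> \bar R) (z : R) :
  measurable_fun setT G -> measurable_fun setT (fun y => G (tuple_cons (z, y))).
Proof.
move=> mG; apply: (@measurableT_comp _ _ _ _ _ _ G _ (fun y => tuple_cons (z, y)) mG).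
apply: (@measurableT_comp _ _ _ _ _ _ (@tuple_cons R n) _ (fun y => (z, y))).
  exact: measurable_tuple_cons.
exact: measurable_pair1.
Qed.

Lemma integral_product_lawS n (P : 'I_n.+1 -> probability R R)
    (G : n.+1.-tuple R -> \bar R) :
  measurable_fun setT G -> (forall y, 0 <= G y) ->
  \int[product_law P]_y G y =
  \int[P ord0]_z \int[product_law (fun i => P (lift ord0 i))]_y G (tuple_cons (z, y)).
Proof.
move=> mG G0; rewrite /= ge0_integral_distribution//.
rewrite /pair_law fubini_tonelli1//; last by move=> x; exact: G0.
by apply: measurableT_comp => //; exact: measurable_tuple_cons.
Qed.

(** The same decomposition, with the first coordinate integrated first.
*)
Lemma integral_product_lawS_swap n (P : 'I_n.+1 -> probability R R)
    (G : n.+1.-tuple R -> \bar R) :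
  measurable_fun setT G -> (forall y, 0 <= G y) ->
  \int[product_law P]_y G y =
  \int[product_law (fun i => P (lift ord0 i))]_y \int[P ord0]_z G (tuple_cons (z, y)).
Proof.
move=> mG G0; rewrite /= ge0_integral_distribution//.
rewrite /pair_law fubini_tonelli2//; last by move=> x; exact: G0.
by apply: measurableT_comp => //; exact: measurable_tuple_cons.
Qed.

Lemma measurable_integral_tail n (P : 'I_n -> probability R R)
    (G : n.+1.-tuple R -> \bar R) :
  measurable_fun setT G -> (forall y, 0 <= G y) ->
  measurable_fun setT (fun z => \int[product_law P]_y G (tuple_cons (z, y))).
Proof.
move=> mG G0.
apply: (@measurable_fun_fubini_tonelli_F _ _ _ _ _ (product_law P)
  (fun zy => G (tuple_cons zy))) => //.
by apply: measurableT_comp => //; exact: measurable_tuple_cons.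
Qed.

Lemma measurable_integral_head n (P : probability R R)
    (G : n.+1.-tuple R -> \bar R) :
  measurable_fun setT G -> (forall y, 0 <= G y) ->
  measurable_fun setT (fun y => \int[P]_z G (tuple_cons (z, y))).
Proof.
move=> mG G0.
apply: (@measurable_fun_fubini_tonelli_G _ _ _ _ _ P
  (fun zy => G (tuple_cons zy))) => //.
by apply: measurableT_comp => //; exact: measurable_tuple_cons.
Qed.

Definition tuple_update n (y : n.-tuple R) (i : 'I_n) (v : R) : n.-tuple R :=
  [tuple if j == i then v else tnth y j | j < n].

Lemma tnth_tuple_update n (y : n.-tuple R) i v j :
  tnth (tuple_update y i v) j = if j == i then v else tnth y j.
Proof. by rewrite tnth_mktuple. Qed.

(** A bound on the integral over one coordinate, uniform in the others, bounds
    the whole integral.  Stating it with the coordinate overwritten in a full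
    tuple avoids a separate type for the tuple of the other coordinates.
*)
Lemma integral_le_resample n (P : 'I_n -> probability R R) (i : 'I_n)
    (G : n.-tuple R -> \bar R) (c : \bar R) :
  measurable_fun setT G -> (forall y, 0 <= G y) -> 0 <= c ->
  (forall y, \int[P i]_v G (tuple_update y i v) <= c) ->
  \int[product_law P]_y G y <= c.
Proof.
elim: n P i G => [|n IH] P i; first by case: i.
move=> G mG G0 c0 h.
case: (unliftP ord0 i) => [j ij|i0]; last first.
  rewrite integral_product_lawS_swap//.
  apply: (@le_trans _ _ (\int[product_law (fun i => P (lift ord0 i))]_y c)); last first.
    by rewrite integral_cst_probability.
  apply: ge0_le_integral => //.
  - by move=> y _; apply: integral_ge0.
  - exact: measurable_integral_head.
  - move=> y _; have := h (tuple_cons (0%R, y)); rewrite i0.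
    apply: le_trans; rewrite le_eqVlt; apply/orP; left; apply/eqP.
    apply: eq_integral => v _; congr G; apply: eq_from_tnth => k.
    rewrite tnth_tuple_update; case: (unliftP ord0 k) => [l ->|->].
      by rewrite !tnthS.
    by rewrite eqxx tnth0.
rewrite integral_product_lawS//.
apply: (@le_trans _ _ (\int[P ord0]_y c)); last first.
  by rewrite integral_cst_probability.
apply: ge0_le_integral => //.
- by move=> y _; apply: integral_ge0.
- exact: measurable_integral_tail.
- move=> z _; apply: (IH _ j) => //.
    exact: measurable_tuple_cons_pair.
  move=> y; have := h (tuple_cons (z, y)); rewrite ij.
  apply: le_trans; rewrite le_eqVlt; apply/orP; left; apply/eqP.
  apply: eq_integral => v _; congr G; apply: eq_from_tnth => k.
  rewrite tnth_tuple_update; case: (unliftP ord0 k) => [l ->|->].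
    by rewrite !tnthS tnth_tuple_update (inj_eq (@lift_inj _ ord0)).
  by rewrite !tnth0.
Qed.

(** Independence in the form needed for exponential moments: an inequality for
    nonnegative factors, so that no integrability has to be checked.
*)
Lemma integral_prod_le n (P : 'I_n -> probability R R) (g : 'I_n -> R -> R)
    (c : 'I_n -> R) :
  (forall i, measurable_fun setT (g i)) -> (forall i x, (0 <= g i x)%R) ->
  (forall i, \int[P i]_x (g i x)%:E <= (c i)%:E) ->
  \int[product_law P]_y (\prod_i g i (tnth y i))%:E <= (\prod_i c i)%:E.
Proof.
elim: n P g c => [|n IH] P g c mg g0 gc.
  rewrite big_ord0; under eq_integral do rewrite big_ord0.
  by rewrite integral_cst_probability.
have mgy k (h : 'I_k -> R -> R) : (forall i, measurable_fun setT (h i)) ->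
    measurable_fun setT (fun y : k.-tuple R => (\prod_i h i (tnth y i))%:E).
  move=> mh; apply/measurable_EFinP; apply: measurable_prod => i _.
  apply: measurableT_comp => //; exact: measurable_tnth.
have g0y k (h : 'I_k -> R -> R) : (forall i x, (0 <= h i x)%R) ->
   forall y : k.-tuple R, 0 <= (\prod_i h i (tnth y i))%:E.
  by move=> h0 y; rewrite lee_fin prodr_ge0.
have c0 i : (0 <= c i)%R.
  by rewrite -lee_fin (le_trans _ (gc i))// integral_ge0// => x _; rewrite lee_fin.
rewrite integral_product_lawS//; [|exact: mgy|exact: g0y].
pose g' (i : 'I_n) := g (lift ord0 i).
apply: (@le_trans _ _ (\int[P ord0]_z ((g ord0 z)%:E * (\prod_(i < n) c (lift ord0 i))%:E))).
  apply: ge0_le_integral => //.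
  - by move=> z _; apply: integral_ge0 => y _; exact: g0y.
  - apply: (@measurable_integral_tail n _ (fun y => (\prod_i g i (tnth y i))%:E)).
      exact: (mgy _ g).
    by move=> y; exact: g0y.
  - by apply: emeasurable_funM => //; apply/measurable_EFinP; exact: mg.
  - move=> z _.
    rewrite (eq_integral (fun y => (g ord0 z)%:E * (\prod_i g' i (tnth y i))%:E)); last first.
      move=> y _; rewrite big_ord_recl EFinM tnth0; congr (_ * _%:E).
      by apply: eq_bigr => i _; rewrite tnthS.
    rewrite ge0_integralZl//=.
    + apply: lee_pmul => //; [by rewrite lee_fin|by apply: integral_ge0 => y _; apply: (g0y _ g') => i; exact: g0|].
      by apply: (IH _ g' (fun i => c (lift ord0 i))) => i; rewrite /g'.
    + by apply: (mgy _ g') => i; exact: mg.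
    + by move=> y _; apply: (g0y _ g') => i; exact: g0.
    + by rewrite lee_fin.
rewrite ge0_integralZr//=; last 3 first.
- by apply/measurable_EFinP; exact: mg.
- by move=> x _; rewrite lee_fin.
- by rewrite lee_fin prodr_ge0.
by rewrite big_ord_recl EFinM lee_pmul// ?integral_ge0// ?lee_fin ?prodr_ge0// => x _; rewrite lee_fin.
Qed.

Lemma product_law_marginal n (P : 'I_n -> probability R R) i (A : set R) :
  measurable A -> product_law P [set y | A (tnth y i)] = P i A.
Proof.
move=> mA; pose B j := if j == i then A else setT.
have -> : [set y : n.-tuple R | A (tnth y i)] = [set y | forall j, B j (tnth y j)].
  apply/seteqP; split=> y /=; rewrite /B; last by move=> /(_ i); rewrite eqxx.
  by move=> Ay j; case: eqP => // ->.
rewrite product_lawE; last by move=> j; rewrite /B; case: ifP.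
rewrite (bigD1 i)//= /B eqxx big1 ?mule1// => j /negbTE ->.
exact: probability_setT.
Qed.

Lemma measurable_set_tnth n (i : 'I_n) (A : set R) : measurable A ->
  measurable [set y : n.-tuple R | A (tnth y i)].
Proof.
by move=> mA; rewrite -[X in measurable X]setTI; exact: measurable_tnth.
Qed.

End product_integrals.

(** * The Benjamini-Hochberg procedure and order statistics *)
Section BH_theory.
Context {R : realType}.

(** For a level at most 1, [BH] rejects the largest self-consistent set
    ([self_consistent_BH], [self_consistent_sub_BH]).  This description replaces
    the threshold, a supremum of reals, by finitely many comparisons of p-values
    with the numbers [alpha * r / n].
*)
Definition self_consistent n (alpha : R) (p : 'I_n -> R) (S : {set 'I_n}) :=
  forall j, j \in S -> p j <= alpha * #|S|%:R / n%:R.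

Lemma self_consistent_BH n (alpha : R) (y : n.-tuple R) u s : 0 < alpha ->
  self_consistent alpha (pvalue y u s) (BH alpha y u s).
Proof.
move=> a0 j; rewrite inE => /le_trans; apply.
have n0 : (0 < n)%N by apply: leq_ltn_trans (ltn_ord j).
have [[_ +] _] := BH_threshold_max y u s a0.
rewrite ler_pdivrMr// ler_pdivlMr ?ltr0n// mulrC => /le_trans; apply.
by rewrite mulrC.
Qed.

Lemma self_consistent_sub_BH n (alpha : R) (y : n.-tuple R) u s S :
  0 < alpha <= 1 -> self_consistent alpha (pvalue y u s) S ->
  S \subset BH alpha y u s.
Proof.
move=> /andP[a0 a1] Ssc; apply/fintype.subsetP => i iS; rewrite inE.
have n0 : (0 < n)%N by apply: leq_ltn_trans (ltn_ord i).
have n0R : 0 < n%:R :> R by rewrite ltr0n.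
apply: (le_trans (Ssc _ iS)).
have [_ ubT] := BH_threshold_max y u s a0; apply: ubT; split.
  apply/andP; split; first by rewrite divr_ge0// mulr_ge0// ltW.
  rewrite ler_pdivrMr//; apply: ler_pM => //; first exact: ltW.
  by rewrite ler_nat -[X in (_ <= X)%N]card_ord max_card.
rewrite (_ : n%:R * _ / _ = #|S|%:R); last by field; rewrite ?gt_eqF.
rewrite ler_nat subset_leq_card//.
by apply/fintype.subsetP => j jS; rewrite inE; exact: Ssc.
Qed.

Lemma sub_self_consistent n (alpha : R) (p : 'I_n -> R) (S S' : {set 'I_n}) j :
  0 < alpha -> S \subset S' -> p j <= alpha * #|S|%:R / n%:R ->
  p j <= alpha * #|S'|%:R / n%:R.
Proof.
move=> a0 SS' /le_trans; apply; rewrite ler_wpM2r ?invr_ge0//.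
by rewrite ler_wpM2l ?(ltW a0)// ler_nat subset_leq_card.
Qed.

Lemma BH_stable_sub n (alpha : R) (y y' : n.-tuple R) u u' s i :
  0 < alpha <= 1 -> (forall j, j != i -> pvalue y u s j = pvalue y' u' s j) ->
  i \in BH alpha y u s -> BH alpha y' u' s \subset BH alpha y u s.
Proof.
move=> a01 pp iR; have /andP[a0 _] := a01.
apply: fintype.subset_trans (_ : BH alpha y u s :|: BH alpha y' u' s \subset _)%SET.
  exact: finset.subsetUr.
apply: self_consistent_sub_BH => // j.
have [->{j} _|ji] := eqVneq j i.
  apply: (sub_self_consistent a0 (finset.subsetUl _ _)).
  exact: self_consistent_BH.
rewrite inE => /orP[jR|jR'].
  apply: (sub_self_consistent a0 (finset.subsetUl _ _)).
  exact: self_consistent_BH.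
rewrite pp//; apply: (sub_self_consistent a0 (finset.subsetUr _ _)).
exact: self_consistent_BH.
Qed.

(** The union of the two sets of rejections is self-consistent for both data,
    because the only p-value that differs belongs to a hypothesis rejected both
    times.
*)
Lemma BH_stable n (alpha : R) (y y' : n.-tuple R) u u' s i :
  0 < alpha <= 1 -> (forall j, j != i -> pvalue y u s j = pvalue y' u' s j) ->
  i \in BH alpha y u s -> i \in BH alpha y' u' s ->
  BH alpha y u s = BH alpha y' u' s.
Proof.
move=> a01 pp iR iR'; apply/eqP; rewrite finset.eqEsubset.
apply/andP; split.
  by apply: (BH_stable_sub (i := i)) => // j ji; rewrite pp.
exact: (BH_stable_sub (i := i)).
Qed.

Lemma BH_sub n (alpha alpha' : R) (y y' : n.-tuple R) u u' s :
  0 < alpha -> 0 < alpha' <= 1 ->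
  (forall j (r : nat), (0 < r <= n)%N -> pvalue y u s j <= alpha * r%:R / n%:R ->
     pvalue y' u' s j <= alpha' * r%:R / n%:R) ->
  BH alpha y u s \subset BH alpha' y' u' s.
Proof.
move=> a0 a'01 h; apply: self_consistent_sub_BH => // j jS.
apply: h; last exact: self_consistent_BH.
apply/andP; split; first by apply/card_gt0P; exists j.
by rewrite -[X in (_ <= X)%N]card_ord max_card.
Qed.

Lemma bonferroni_BH n (alpha : R) (y : n.-tuple R) u s i :
  0 < alpha <= 1 -> pvalue y u s i <= alpha / n%:R -> i \in BH alpha y u s.
Proof.
move=> a01 h; apply: (fintype.subsetP (self_consistent_sub_BH a01 _)) (set11 i).
by move=> j; rewrite finset.inE => /eqP->; rewrite cards1 mulr1.
Qed.

Definition count_lt n (y : n.-tuple R) x := #|[set j | tnth y j < x]%SET|.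
Definition count_le n (y : n.-tuple R) x := #|[set j | tnth y j <= x]%SET|.

Lemma card_count n (y : n.-tuple R) (p : pred R) :
  #|[set j | p (tnth y j)]%SET| = count p y.
Proof.
rewrite cardE -[in RHS](map_tnth_enum y) count_map size_filter -enumT.
by rewrite enumT; apply: eq_count => j; rewrite /= inE.
Qed.

(** These two counts characterize the order statistic ([order_stat_uniq]), and
    the effect of changing one coordinate is read off them.
*)
Lemma order_statP n (y : n.-tuple R) m : (0 < m <= n)%N ->
  (count_lt y (order_stat y m) < m <= count_le y (order_stat y m))%N.
Proof.
move=> /andP[m0 mn].
pose s := sort <=%R y; have ss : size s = n by rewrite size_sort size_tuple.
have srt : sorted <=%R s by apply: sort_sorted; exact: le_total.
have ps : perm_eq s y by rewrite perm_sort.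
have m1 : (m.-1 < n)%N by rewrite prednK.
rewrite /count_lt /count_le (card_count y (fun z => z < order_stat y m)).
rewrite (card_count y (fun z => z <= order_stat y m)) -!(permP ps).
have hle i j : (i <= j < n)%N -> s`_i <= s`_j.
  move=> /andP[ij jn]; apply: (sorted_leq_nth le_trans le_refl) => //; rewrite ?inE ss//.
  exact: leq_ltn_trans jn.
rewrite -/(s) -(cat_take_drop m.-1 s) count_cat.
rewrite -[X in (_ <= count _ X)%N](_ : take m s ++ drop m s = _); last first.
  by rewrite !cat_take_drop.
rewrite count_cat /order_stat -/s; apply/andP; split.
  rewrite [X in (_ + X)%N](_ : _ = 0%N) ?addn0.
    rewrite (leq_ltn_trans (count_size _ _))// size_take ss m1.
    by rewrite prednK.
  apply/eqP; rewrite -leqn0 leqNgt -has_count; apply/negP => /(has_nthP 0)[i].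
  rewrite size_drop ss => ilt; rewrite nth_drop ltNge hle// leq_addr/=.
  by rewrite -ltn_subRL.
apply: leq_trans (leq_addr _ _).
have -> : count (<= s`_m.-1) (take m s) = size (take m s).
  apply/eqP; rewrite -all_count; apply/(all_nthP 0) => i.
  rewrite size_take ss => im; have {}im : (i < m)%N.
    by move: im; case: (ltnP m n) => // nm /leq_trans; apply.
  by rewrite nth_take//= hle// m1 andbT -ltnS prednK.
by rewrite size_takel ?ss.
Qed.

Lemma leq_count_le n (y : n.-tuple R) x x' : x <= x' -> (count_le y x <= count_le y x')%N.
Proof.
move=> xx'; apply/subset_leq_card/fintype.subsetP => j; rewrite !inE => /le_trans; exact.
Qed.

Lemma leq_count_le_lt n (y : n.-tuple R) x x' : x < x' -> (count_le y x <= count_lt y x')%N.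
Proof.
move=> xx'; apply/subset_leq_card/fintype.subsetP => j; rewrite !inE => /le_lt_trans; exact.
Qed.

Lemma order_stat_uniq n (y : n.-tuple R) m x x' :
  (count_lt y x < m <= count_le y x)%N -> (count_lt y x' < m <= count_le y x')%N -> x = x'.
Proof.
move=> /andP[a b] /andP[c d]; have [xx'|x'x|//] := ltgtP x x'.
  by have := leq_trans b (leq_count_le_lt y xx'); rewrite leqNgt c.
by have := leq_trans d (leq_count_le_lt y x'x); rewrite leqNgt a.
Qed.

Lemma order_stat_le n (y : n.-tuple R) m x : (0 < m <= n)%N ->
  (order_stat y m <= x) = (m <= count_le y x)%N.
Proof.
move=> mn; have /andP[a b] := order_statP y mn; apply/idP/idP.
  by move=> /leq_count_le h; exact: leq_trans b (h _ _).
by apply: contraTT; rewrite -ltNge -ltnNge => /(leq_count_le_lt y) h; exact: leq_ltn_trans a.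
Qed.

Lemma order_stat_ge n (y : n.-tuple R) m x : (0 < m <= n)%N ->
  (x <= order_stat y m) = (count_lt y x < m)%N.
Proof.
move=> mn; have /andP[a b] := order_statP y mn; apply/idP/idP.
  move=> h; apply: leq_ltn_trans a; apply/subset_leq_card/fintype.subsetP => j.
  by rewrite !inE => /lt_le_trans; apply.
by apply: contraTT; rewrite -ltNge -leqNgt => /(leq_count_le_lt y) h; exact: leq_trans b h.
Qed.

(** Moving a point that lies above the order statistic, while keeping it above,
    changes none of the two counts.
*)
Lemma order_stat_update_gt n (y : n.-tuple R) m i v : (0 < m <= n)%N ->
  order_stat y m < tnth y i -> order_stat y m < v ->
  order_stat (tuple_update y i v) m = order_stat y m.
Proof.
move=> mn yi vi; apply: (@order_stat_uniq _ (tuple_update y i v) m).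
  exact: order_statP.
have := order_statP y mn; set x := order_stat y m in yi vi *.
rewrite (_ : count_lt (tuple_update y i v) x = count_lt y x); last first.
  apply: eq_card => j; rewrite !inE tnth_tuple_update; case: eqP => // ->.
  by rewrite !ltNge !ltW.
rewrite (_ : count_le (tuple_update y i v) x = count_le y x)//.
apply: eq_card => j; rewrite !inE tnth_tuple_update; case: eqP => // ->.
by rewrite !leNgt yi vi.
Qed.

Lemma order_stat_update_lt n (y : n.-tuple R) m i v : (0 < m <= n)%N ->
  tnth y i < order_stat y m -> v < order_stat y m ->
  order_stat (tuple_update y i v) m = order_stat y m.
Proof.
move=> mn yi vi; apply: (@order_stat_uniq _ (tuple_update y i v) m).
  exact: order_statP.
have := order_statP y mn; set x := order_stat y m in yi vi *.
rewrite (_ : count_lt (tuple_update y i v) x = count_lt y x); last first.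
  by apply: eq_card => j; rewrite !inE tnth_tuple_update; case: eqP => // ->; rewrite yi vi.
rewrite (_ : count_le (tuple_update y i v) x = count_le y x)//.
by apply: eq_card => j; rewrite !inE tnth_tuple_update; case: eqP => // ->; rewrite !ltW.
Qed.

End BH_theory.

(** * Measurability of the procedures *)
Section measurability.
Context {R : realType}.

Lemma measurable_finite_image d (X : measurableType d) (F : finType) (f : X -> F)
    (Q : set F) :
  (forall a, measurable [set x | f x = a]) -> measurable [set x | Q (f x)].
Proof.
move=> mf; have -> : [set x | Q (f x)] = \bigcup_(a in Q) [set x | f x = a].
  apply/seteqP; split=> x /=; first by exists (f x).
  by case=> a Qa fxa; rewrite fxa.
by apply: fin_bigcup_measurable => //; exact: finite_finset.
Qed.

Lemma measurable_bool_set d (X : measurableType d) (F : finType) (b : F -> X -> bool)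
    (S : {set F}) :
  (forall a, measurable [set x | b a x]) ->
  measurable [set x | [set a | b a x]%SET = S].
Proof.
move=> mb; have -> : [set x | [set a | b a x]%SET = S] =
    \bigcap_(a in setT) [set x | b a x = (a \in S)].
  apply/seteqP; split=> x /=; first by move=> <- a _ /=; rewrite inE.
  by move=> h; apply/setP => a; rewrite inE; exact: h.
apply: fin_bigcap_measurable => //.
move=> a _; case: (a \in S); first exact: mb.
rewrite (_ : [set x | _] = ~` [set x | b a x]); first exact/measurableC/mb.
by apply/seteqP; split=> x /=; case: (b a x).
Qed.

Lemma measurable_order_stat n m : (0 < m <= n)%N ->
  measurable_fun setT (fun y : n.-tuple R => order_stat y m).
Proof.
move=> mn; apply: (measurability (@RGenCInfty.G R)) => [|/= _ [_] [x] -> <-].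
  exact: RGenCInfty.measurableE.
rewrite setTI (_ : _ @^-1` _ = [set y | [set S : {set 'I_n} | (#|S| < m)%N]
    [set j | tnth y j < x]%SET]); last first.
  by apply/seteqP; split=> y /=; rewrite in_itv/= andbT order_stat_ge.
apply: (measurable_finite_image (f := fun y : n.-tuple R => [set j | tnth y j < x]%SET)).
move=> S; apply: measurable_bool_set => j.
rewrite (_ : [set y | _] = [set y | `]-oo, x[%classic (tnth y j)]).
  exact: measurable_set_tnth.
by apply/seteqP; split=> y /=; rewrite in_itv.
Qed.

Lemma measurable_upper_tail : measurable_fun setT (@upper_tail R).
Proof.
apply: nonincreasing_measurable => // x y xy; exact: le_upper_tail.
Qed.

Lemma measurable_pvalue n (u : n.-tuple R -> R) s i :
  measurable_fun setT u -> measurable_fun setT (fun y => pvalue y (u y) s i).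
Proof.
move=> mu; apply: measurable_funM => //.
apply: (measurableT_comp measurable_upper_tail).
apply: measurable_funM => //; apply: measurableT_comp => //.
by apply: measurable_funB => //; exact: measurable_tnth.
Qed.

(** Being the largest self-consistent set is a finite Boolean combination of
    comparisons of p-values with constants.
*)
Lemma measurable_BH n alpha (u : n.-tuple R -> R) s S : 0 < alpha <= 1 ->
  measurable_fun setT u -> measurable [set y | BH alpha y (u y) s = S].
Proof.
move=> a01 mu; have /andP[a0 _] := a01.
have msc (S' : {set 'I_n}) :
    measurable [set y | self_consistent alpha (pvalue y (u y) s) S'].
  rewrite (_ : [set y | _] = \bigcap_(j in [set j | j \in S'])
      [set y | pvalue y (u y) s j <= alpha * #|S'|%:R / n%:R]).
    apply: fin_bigcap_measurable => [|j _]; first exact: finite_finset.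
    rewrite (_ : [set y | _] = (fun y => pvalue y (u y) s j) @^-1`
      `]-oo, alpha * #|S'|%:R / n%:R]).
      by rewrite -[X in measurable X]setTI; exact: measurable_pvalue.
    by apply/seteqP; split=> y /=; rewrite in_itv.
  by apply/seteqP; split=> y /= h j; exact: h.
rewrite (_ : [set y | _] = [set y | self_consistent alpha (pvalue y (u y) s) S] `&`
  \bigcap_(S' in [set S' : {set 'I_n} | ~~ (S' \subset S)])
    ~` [set y | self_consistent alpha (pvalue y (u y) s) S']).
  apply: measurableI; first exact: msc.
  apply: fin_bigcap_measurable => [|S' _]; first exact: finite_finset.
  by apply: measurableC; exact: msc.
apply/seteqP; split=> y /=.
  move=> <-; split; first exact: self_consistent_BH.
  by move=> S' /= /negP h sc; apply: h; exact: self_consistent_sub_BH.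
move=> [scS h]; apply/eqP; rewrite finset.eqEsubset (self_consistent_sub_BH a01 scS) andbT.
apply: contrapT => /negP /h; apply; exact: self_consistent_BH.
Qed.

Lemma uphalf_bounds n : (0 < n)%N -> (0 < uphalf n <= n)%N.
Proof. by move=> n0; rewrite uphalf_gt0 n0 leq_uphalf_double -addnn leq_addr. Qed.

Lemma measurable_median n : measurable_fun setT (@median R n).
Proof.
case: n => [|n]; last exact: measurable_order_stat (uphalf_bounds _).
rewrite (_ : median (n := 0) = cst 0)//.
by apply/funext => y; rewrite /median tuple0 /order_stat/=.
Qed.

End measurability.

(** * Null parameters and deviation of the sample median *)
Section model_theory.
Context {R : realType}.
Notation model n := ('I_n -> probability R R).

Lemma majorities_meet n (A B : {set 'I_n}) :
  (n < 2 * #|A|)%N -> (n < 2 * #|B|)%N -> exists2 i, i \in A & i \in B.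
Proof.
move=> hA hB; have hU : (#|A :|: B| <= n)%N.
  by rewrite -[X in (_ <= X)%N]card_ord max_card.
have /card_gt0P[i /finset.setIP[]] : (0 < #|A :&: B|)%N; last by exists i.
rewrite lt0n; apply/eqP => e0; have := cardsUI A B; rewrite e0 addn0.
move: #|A| #|B| #|A :|: B| hA hB hU => a b c hA hB hU eU.
have : (n + n < 2 * a + 2 * b)%N by rewrite -addSn leq_add// ltnW.
by rewrite -mulnDr -eU ltnNge mul2n -addnn leq_add.
Qed.

Lemma mem_asbool_set (T : finType) (Q : T -> Prop) i : i \in [set j | `[< Q j >]]%SET -> Q i.
Proof. by rewrite finset.in_set => /asboolP. Qed.

(** Two majorities share a coordinate, and a Gaussian law determines its
    parameters.
*)
Lemma null_parameter_uniq n (P : model n) ts ts' :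
  null_parameter P ts -> null_parameter P ts' -> ts = ts'.
Proof.
case: ts ts' => [t s] [t' s'] [s0 hs] [s'0 hs'].
have [i /mem_asbool_set h /mem_asbool_set h'] := majorities_meet hs hs'.
have [] := @normal_prob_inj R t s t' s' s0 s'0; last by move=> -> ->.
by move=> B mB; rewrite -(h B mB) (h' B mB).
Qed.

Lemma null_parameterE n (P : model n) t s :
  null_parameter P (t, s) -> theta P = t /\ sigma P = s.
Proof.
move=> h; rewrite /theta /sigma; case: xgetP => [ts _ h'|/(_ (t, s))//].
by rewrite (null_parameter_uniq h' h).
Qed.

Lemma in_modelP n (P : model n) : in_model P -> null_parameter P (theta P, sigma P).
Proof.
move=> [[t s] h]; have [-> ->] := null_parameterE h; exact: h.
Qed.

Lemma sigma_gt0 n (P : model n) : in_model P -> 0 < sigma P.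
Proof. by move=> /in_modelP[]. Qed.

Lemma card_H0 n (P : model n) : in_model P -> (n < 2 * #|H0 P|)%N.
Proof. by move=> /in_modelP[]. Qed.

Lemma card_H0_n1 n (P : model n) : (#|H0 P| + n1 P = n)%N.
Proof. by rewrite /n1 /H1 cardsC card_ord. Qed.

Lemma H0P n (P : model n) i : i \in H0 P -> gaussian_at P (theta P) (sigma P) i.
Proof. exact: mem_asbool_set. Qed.

Lemma measurable_count_ge n (S : {set 'I_n}) (A : set R) (a : R) : measurable A ->
  measurable [set y : n.-tuple R | a <= #|[set j in S | tnth y j \in A]%SET|%:R].
Proof.
move=> mA; apply: (@measurable_finite_image _ _ _ (fun y : n.-tuple R =>
  [set j in S | tnth y j \in A]%SET) [set T : {set 'I_n} | a <= #|T|%:R]).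
move=> T; apply: measurable_bool_set => j.
rewrite (_ : [set y | _] = [set y | (if j \in S then A else set0) (tnth y j)]).
  by apply: measurable_set_tnth; case: ifP.
by apply/seteqP; split=> y /=; case: (j \in S) => //=; rewrite inE.
Qed.

Lemma expR_le1DxD2x2 (t : R) : 0 <= t <= 2^-1 -> expR t - 1 <= t + 2 * t ^+ 2.
Proof.
move=> /andP[t0 t1]; have h := expR_ge1Dx (- t).
have t2 : 0 < 1 - t by lra.
have : expR t <= (1 - t)^-1.
  by rewrite -[t]opprK expRN lef_pV2 ?posrE ?expR_gt0 ?opprK.
rewrite lerBlDr => /le_trans; apply; rewrite invf_ple ?posrE//; last by nra.
by rewrite -[leLHS]mul1r ler_pdivrMr; nra.
Qed.

(** Markov's inequality for [expR (tau * N)], where [N] is the count: a product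
    of functions of the independent coordinates, equal to 1 outside [S].
*)
Lemma chernoff_count n (P : model n) (S : {set 'I_n}) (A : set R) (p tau a : R) :
  measurable A -> 0 <= tau <= 2^-1 -> (forall i, i \in S -> P i A <= p%:E)%E ->
  (product_law P [set y | (a <= #|[set j in S | tnth y j \in A]%SET|%:R)%R]
    <= (expR (#|S|%:R * (p * (tau + 2 * tau ^+ 2)) - tau * a))%:E)%E.
Proof.
move=> mA /andP[t0 t1] hp.
pose g (j : 'I_n) (z : R) := if j \in S then expR (tau * \1_A z) else 1.
pose q := expR (p * (tau + 2 * tau ^+ 2)).
pose c (j : 'I_n) := if j \in S then q else 1.
have mg j : measurable_fun setT (g j).
  rewrite /g; case: (j \in S) => //.
  apply: measurableT_comp => //; apply: measurable_funM => //.
have g0 j x : 0 <= g j x by rewrite /g; case: ifP => //; rewrite expR_ge0.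
have gc j : (\int[P j]_x (g j x)%:E <= (c j)%:E)%E.
  rewrite /g /c; case: ifPn => jS; last by rewrite integral_cst_probability.
  have e0 : 0 <= expR tau - 1 by rewrite subr_ge0 -[leLHS]expR0 ler_expR.
  rewrite (eq_integral (fun x => (1%:E + (expR tau - 1)%:E * (\1_A x)%:E)%E)); last first.
    move=> x _; rewrite indicE; case: (x \in A) => /=; rewrite ?mulr1 ?mulr0 ?expR0 ?mule1 ?mule0 ?adde0//.
    by rewrite -EFinD; congr EFin; ring.
  rewrite ge0_integralD//=; last 2 first.
  - by move=> x _; rewrite -EFinM lee_fin mulr_ge0.
  - by apply: measurable_funeM; apply/measurable_EFinP; exact: measurable_indic.
  rewrite integral_cst_probability ge0_integralZl//; last first.
    by apply/measurable_EFinP; exact: measurable_indic.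
  rewrite integral_indic// setIT.
  have hA := hp _ jS.
  apply: (@le_trans _ _ (1 + (expR tau - 1)%:E * p%:E)%E).
    by rewrite leeD2l// lee_wpmul2l// lee_fin.
  rewrite -EFinM -EFinD lee_fin (le_trans (expR_ge1Dx _))// ler_expR mulrC.
  have p0 : 0 <= p by rewrite -lee_fin (le_trans _ hA).
  by rewrite ler_wpM2l// expR_le1DxD2x2// t0.
have := integral_prod_le mg g0 gc.
rewrite (_ : \prod_i c i = q ^+ #|S|); last first.
  by rewrite /c -big_mkcond/= prodr_const.
set E := [set y | _] => hI.
have mE : measurable E by exact: measurable_count_ge.
have hpt y : ((\1_E y)%:E <= (expR (- (tau * a)))%:E * (\prod_i g i (tnth y i))%:E)%E.
  rewrite -EFinM lee_fin.
  have -> : \prod_i g i (tnth y i) = expR (tau * #|[set j in S | tnth y j \in A]|%:R).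
    rewrite /g -big_mkcond/= -expR_sum -mulr_sumr; congr expR; congr (_ * _).
    rewrite -sum1_card natr_sum [RHS]big_mkcond [LHS]big_mkcond; apply: eq_bigr => j _.
    by rewrite inE indicE; case: (j \in S); case: (_ \in A).
  rewrite -expRD indicE; case: (boolP (y \in E)) => [|_]; last by rewrite expR_ge0.
  rewrite inE /E/= => ya; rewrite -[leLHS]expR0 ler_expR addrC subr_ge0.
  by rewrite ler_wpM2l.
have -> : product_law P E = (\int[product_law P]_y (\1_E y)%:E)%E.
  by rewrite integral_indic// setIT.
have mprod : measurable_fun setT (fun y : n.-tuple R => (\prod_i g i (tnth y i))%:E).
  apply/measurable_EFinP; apply: measurable_prod => i _.
  by apply: measurableT_comp => //; exact: measurable_tnth.
apply: (@le_trans _ _ (\int[product_law P]_y ((expR (- (tau * a)))%:E * (\prod_i g i (tnth y i))%:E))%E).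
  apply: ge0_le_integral => //.
  - by apply/measurable_EFinP; exact: measurable_indic.
  - by apply: measurable_funeM.
rewrite ge0_integralZl//; last by move=> y _; rewrite lee_fin prodr_ge0.
apply: (le_trans (lee_wpmul2l _ hI)); first by rewrite lee_fin expR_ge0.
by rewrite -EFinM lee_fin /q -expRM_natl -expRD addrC.
Qed.


Lemma measurable_median_deviation n (t d : R) :
  measurable [set y : n.-tuple R | d < `|median y - t|].
Proof.
rewrite (_ : [set y | _] = (fun y : n.-tuple R => `|median y - t|) @^-1` `]d, +oo[).
  rewrite -[X in measurable X]setTI.
  have : measurable_fun setT (fun y : n.-tuple R => `|median y - t|).
    apply: measurableT_comp => //; apply: measurable_funB => //.
    exact: measurable_median.
  by apply.
by apply/seteqP; split=> y /=; rewrite in_itv/= andbT.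
Qed.

(** If the median exceeds [theta + d * sigma], at least [n / 2] points do, hence
    at least [n / 2 - n1] null points, whereas each of them does so with
    probability [upper_tail d <= 1 / 2 - normal_pdf 0 1 1 * d] only.  The
    condition on [d] makes this deficit exceed the [k / 2] points that the
    alternatives may supply by [2 * tau * n].
*)
Lemma median_deviation n (P : model n) (k tau d : R) : (0 < n)%N -> in_model P ->
  (n1 P)%:R <= k -> 0 < tau <= 2^-1 -> 0 <= d <= 1 ->
  k + 4 * tau * n%:R <= normal_pdf 0 1 1 * d * n%:R ->
  (product_law P [set y | (d * sigma P < `|median y - theta P|)%R] <=
   (2 * expR (- (n%:R * tau ^+ 2)))%:E)%E.
Proof.
move=> n0 Pm n1k /andP[tau0 tau1] /andP[d0 d1] hd.
have s0 := sigma_gt0 Pm; have mn := uphalf_bounds n0.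
set h := uphalf n in mn.
have n0R : 0 < n%:R :> R by rewrite ltr0n.
have hn : n%:R / 2 <= h%:R :> R.
  rewrite ler_pdivrMr// -natrM ler_nat muln2 /h -leq_uphalf_double//.
have eq0 : #|H0 P|%:R = n%:R - (n1 P)%:R :> R.
  have /(congr1 (fun m => m%:R : R)) := card_H0_n1 P; rewrite natrD => <-.
  by rewrite addrK.
have h0 : n%:R / 2 <= #|H0 P|%:R :> R.
  by rewrite ler_pdivrMr// -natrM ler_nat mulnC ltnW// card_H0.
have hp : upper_tail d <= 2^-1 - normal_pdf 0 1 1 * d.
  have := @upper_tailB_ge R 0 d 1 d0; rewrite normr0 ger0_norm// upper_tail0 => /(_ ler01 d1).
  by rewrite subr0 mulrC; lra.
set q := upper_tail d in hp; have q0 : 0 <= q := upper_tail_ge0 _.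
set c := normal_pdf 0 1 1 in hd hp; have c0 : 0 < c := normal_pdf01_gt0 _.
set x1 : R := (n1 P)%:R in n1k eq0; have x10 : 0 <= x1 by rewrite /x1.
have expo : #|H0 P|%:R * (q * (tau + 2 * tau ^+ 2)) - tau * (n%:R / 2 - x1)
    <= - (n%:R * tau ^+ 2).
  rewrite eq0 in h0 *; set N : R := n%:R in n0R hd h0 *.
  have a1 : (N - x1) * q <= N / 2 - x1 / 2 - c * d * N / 2.
    apply: (@le_trans _ _ ((N - x1) * (2^-1 - c * d))); first by rewrite ler_wpM2l//; lra.
    have : 0 <= (c * d) * (N / 2 - x1) by rewrite mulr_ge0 ?mulr_ge0 ?(ltW c0)//; lra.
    by lra.
  have a2 : (N - x1) * q <= N / 2.
    have : 0 <= c * d * N by apply: mulr_ge0; [exact: mulr_ge0 (ltW c0) d0|exact: ltW].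
    by lra.
  have a3 := ler_wpM2l (ltW tau0) a1.
  have a4 := ler_wpM2r (sqr_ge0 tau) a2.
  have a5 := ler_wpM2l (ltW tau0) hd.
  have a6 := ler_wpM2l (ltW tau0) n1k.
  by lra.
have dev (A : set R) : measurable A ->
    normal_prob (theta P) (sigma P) A = q%:E ->
    (product_law P [set y | (n%:R / 2 - x1 <=
       #|[set j in H0 P | tnth y j \in A]%SET|%:R)%R] <= (expR (- (n%:R * tau ^+ 2)))%:E)%E.
  move=> mA hA; apply: (le_trans (@chernoff_count n P (H0 P) A q tau (n%:R / 2 - x1) mA _ _)).
  - by rewrite (ltW tau0).
  - by move=> i /H0P -> //; rewrite hA.
  - by rewrite lee_fin ler_expR.
pose A1 : set R := `]theta P + d * sigma P, +oo[%classic.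
pose A2 : set R := `]-oo, theta P - d * sigma P[%classic.
have E1 : normal_prob (theta P) (sigma P) A1 = q%:E.
  by rewrite /A1 normal_prob_gt// addrAC subrr add0r mulfK// gt_eqF.
have E2 : normal_prob (theta P) (sigma P) A2 = q%:E.
  by rewrite /A2 normal_prob_lt// opprB addrC subrK mulfK// gt_eqF.
have cover : [set y | (d * sigma P < `|median y - theta P|)%R] `<=`
   [set y : n.-tuple R | (n%:R / 2 - x1 <= #|[set j in H0 P | tnth y j \in A1]%SET|%:R)%R] `|`
   [set y : n.-tuple R | (n%:R / 2 - x1 <= #|[set j in H0 P | tnth y j \in A2]%SET|%:R)%R].
  move=> y /=.
  have split_count (B : pred R) : (#|[set j | B (tnth y j)]%SET| <=
      #|[set j in H0 P | B (tnth y j)]%SET| + n1 P)%N.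
    rewrite -(cardsID (H0 P) [set j | B (tnth y j)]%SET) leq_add//.
      by apply/subset_leq_card/fintype.subsetP => j; rewrite !inE andbC.
    by apply/subset_leq_card/fintype.subsetP => j; rewrite !inE => /andP[].
  have side (B : pred R) (A : set R) : (forall z, B z = (z \in A)) ->
     (n%:R / 2 <= #|[set j | B (tnth y j)]%SET|%:R :> R) ->
     (n%:R / 2 - x1 <= #|[set j in H0 P | tnth y j \in A]%SET|%:R)%R.
    move=> BA hB; rewrite lerBlDr (le_trans hB)// /x1 -natrD ler_nat.
    rewrite (leq_trans (split_count _))// leq_add2r.
    by apply/subset_leq_card/fintype.subsetP => j; rewrite !inE BA.
  rewrite ltr_normr opprB => /orP[hgt|hlt].
    left; apply: (side (fun z => theta P + d * sigma P < z)).
      by move=> z; rewrite /A1 mem_setE/= in_itv/= andbT.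
    have hle := order_stat_le y (theta P + d * sigma P) mn.
    have {hle} : (count_le y (theta P + d * sigma P)%R < h)%N.
      by rewrite ltnNge -hle -ltNge -ltrBrDl.
    rewrite /h ltnNge leq_uphalf_double -ltnNge => hlt.
    rewrite (_ : [set j | _]%SET = ~: [set j | tnth y j <= theta P + d * sigma P])%SET; last first.
      by apply/setP => j; rewrite !inE ltNge.
    rewrite ler_pdivrMr// -natrM ler_nat cardsCs finset.setCK card_ord -/(count_le y _).
    rewrite muln2 doubleB leq_subRL; last first.
      by rewrite (leq_trans (ltnW hlt))// -addnn leq_addr.
    by rewrite -[(n.*2)%N]addnn leq_add2r ltnW.
  right; apply: (side (fun z => z < theta P - d * sigma P)).
    by move=> z; rewrite /A2 mem_setE/= in_itv/=.
  have e := order_stat_ge y (theta P - d * sigma P) mn.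
  apply: (le_trans hn); rewrite ler_nat leqNgt -/(count_lt y _) -e -ltNge -/(median y).
  by move: hlt; lra.
apply: (le_trans (le_measure _ _ _ cover)).
- by rewrite inE; exact: measurable_median_deviation.
- rewrite inE; apply: measurableU; apply: measurable_count_ge; exact: measurable_itv.
- apply: (le_trans (measureU2 _ _ _)); [apply: measurable_count_ge; exact: measurable_itv..|].
  rewrite (mulr_natl (expR _)) (mulr2n (expR _)) EFinD; apply: leeD; apply: dev => //; exact: measurable_itv.
Qed.

End model_theory.

(** * False discovery rate of the plug-in procedure *)
Section upper_bound.
Context {R : realType}.
Notation model n := ('I_n -> probability R R).

Definition tail_ratio (n : nat) (d : R) : R :=
  expR (d * (4 * Num.sqrt (ln n%:R) + 1)) + n%:R^-1.

Definition beyond (b : bool) (x v : R) := if b then x < v else v < x.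

(** The rejection region computed around the wrong centre [x], on one side of
    it, has under the true law at most [tail_ratio n d] times its nominal
    probability [c / 2].
*)
Lemma rejection_window n (b : bool) (x t s c d : R) : (1 < n)%N -> 0 < s ->
  0 <= d <= 1 -> `|x - t| <= d * s -> (2 * n%:R ^+ 2)^-1 <= c <= 1 ->
  exists2 W : set R, measurable W &
    (forall v, beyond b x v -> 2 * upper_tail (`|v - x| / s) <= c -> W v) /\
    (normal_prob t s W <= (tail_ratio n d * (c / 2))%:E)%E.
Proof.
move=> n1 s0 d01 xt /andP[c0 c1].
have n0 : 0 < n%:R :> R by rewrite ltr0n (ltn_trans _ n1).
have cpos : 0 < c by rewrite (lt_le_trans _ c0)// invr_gt0 mulr_gt0 ?exprn_gt0.
have [|z z0 zc] := @upper_tail_quantile R (c / 2).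
  by apply/andP; split; [rewrite divr_gt0|lra].
have hz : upper_tail (z - d) <= tail_ratio n d * (c / 2).
  rewrite -zc; apply: upper_tail_ratio => //; rewrite zc.
  have -> : (4 * n%:R ^+ 2)^-1 = (2 * n%:R ^+ 2)^-1 / 2 :> R by field; rewrite gt_eqF.
  by rewrite ler_wpM2r.
have key w : 2 * upper_tail (w / s) <= c -> z * s <= w.
  by rewrite mulrC -ler_pdivlMr// -zc upper_tail_leE ler_pdivlMr.
have xts : `|(x - t) / s| <= d by rewrite normrM [`|s^-1|]gtr0_norm ?invr_gt0// ler_pdivrMr.
move: xts; rewrite ler_norml => /andP[xts1 xts2].
case: b => /=.
  exists `[x + z * s, +oo[%classic => //; split.
    move=> v xv; rewrite gtr0_norm ?subr_gt0// => /key h.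
    by rewrite /= in_itv/= andbT -lerBrDl.
  rewrite normal_prob_ge// lee_fin (le_trans _ hz)// le_upper_tail//.
  rewrite (_ : (x + z * s - t) / s = z + (x - t) / s); last by field; rewrite gt_eqF.
  by lra.
exists `]-oo, x - z * s]%classic => //; split.
  move=> v vx; rewrite ltr0_norm ?subr_lt0// opprB => /key h.
  by rewrite /= in_itv/= lerBrDl -lerBrDr.
rewrite normal_prob_le// lee_fin (le_trans _ hz)// le_upper_tail//.
rewrite (_ : (t - (x - z * s)) / s = z - (x - t) / s); last by field; rewrite gt_eqF.
by lra.
Qed.

Lemma order_stat_update_beyond n (b : bool) (y : n.-tuple R) m i v : (0 < m <= n)%N ->
  beyond b (order_stat y m) (tnth y i) -> beyond b (order_stat y m) v ->
  order_stat (tuple_update y i v) m = order_stat y m.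
Proof. by case: b; [exact: order_stat_update_gt|exact: order_stat_update_lt]. Qed.

Lemma tuple_update_twice n (y : n.-tuple R) i v w : tuple_update (tuple_update y i v) i w = tuple_update y i w.
Proof. by apply: eq_from_tnth => j; rewrite !tnth_tuple_update; case: eqP. Qed.

(** The value lying beyond the more extreme of the two medians also lies beyond
    the other median, so that passing from one data set to the other does not
    cross the latter.
*)
Lemma median_update_beyond n (b : bool) (y : n.-tuple R) i v w : (0 < n)%N ->
  beyond b (median (tuple_update y i v)) v -> beyond b (median (tuple_update y i w)) w ->
  median (tuple_update y i v) = median (tuple_update y i w).
Proof.
move=> n0; have mn := uphalf_bounds n0; rewrite /median.
set yv := tuple_update y i v; set yw := tuple_update y i w; set m := uphalf n in mn *.
move=> bv bw.
have ev : beyond b (order_stat yv m) w -> order_stat yw m = order_stat yv m.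
  move=> h; rewrite -[yw](tuple_update_twice y i v); apply: (order_stat_update_beyond (b := b)) => //.
  by rewrite tnth_tuple_update eqxx.
have ew : beyond b (order_stat yw m) v -> order_stat yv m = order_stat yw m.
  move=> h; rewrite -[yv](tuple_update_twice y i w); apply: (order_stat_update_beyond (b := b)) => //.
  by rewrite tnth_tuple_update eqxx.
have [h|h] := leP (order_stat yv m) (order_stat yw m).
  case: b bv bw ev ew => /= bv bw ev ew.
    by rewrite ev// (le_lt_trans h).
  by rewrite ew// (lt_le_trans bv).
case: b bv bw ev ew => /= bv bw ev ew.
  by rewrite ew// (lt_trans h).
by rewrite ev// (lt_trans bw).
Qed.

(** The contribution of [i] to the false discovery proportion, restricted to one
    side of the median and to the event that the median is precise.
*)
Definition fdp_share n (alpha t s d : R) (b : bool) (i : 'I_n) (y : n.-tuple R) : R :=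
  let S := BH alpha y (median y) s in
  if [&& i \in S, beyond b (median y) (tnth y i) & `|median y - t| <= d * s]
  then #|S|%:R^-1 else 0.

Lemma fdp_share_ge0 n (alpha t s d : R) b (i : 'I_n) y : 0 <= fdp_share alpha t s d b i y.
Proof. by rewrite /fdp_share; case: ifP. Qed.

Lemma measurable_finite_fun d (X : measurableType d) (F : finType) (f : X -> F)
    (phi : F -> R) :
  (forall a, measurable [set x | f x = a]) -> measurable_fun setT (phi \o f).
Proof.
move=> mf _ Y mY; rewrite setTI.
exact: (@measurable_finite_image _ _ _ f (phi @^-1` Y)).
Qed.

Lemma measurable_tuple_update n (y : n.-tuple R) i : measurable_fun setT (tuple_update y i).
Proof.
apply/measurable_fun_tnthP => j; rewrite /comp.
under eq_fun do rewrite tnth_tuple_update.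
by case: eqP => _; [exact: measurable_id|exact: measurable_cst].
Qed.

Lemma measurable_beyond_median n (b : bool) (i : 'I_n) :
  measurable [set y : n.-tuple R | beyond b (median y) (tnth y i)].
Proof.
have m1 := @measurable_median R n; have m2 := @measurable_tnth _ R n i.
have := measurable_fun_ltr m1 m2; have := measurable_fun_ltr m2 m1.
move=> /(_ measurableT [set true] I); rewrite setTI => h1.
move=> /(_ measurableT [set true] I); rewrite setTI => h2.
by case: b.
Qed.

Lemma measurable_fdp_share n (alpha t s d : R) b (i : 'I_n) : 0 < alpha <= 1 ->
  measurable_fun setT (fdp_share alpha t s d b i).
Proof.
move=> a01.
pose f (y : n.-tuple R) : {set 'I_n} * bool * bool :=
  (BH alpha y (median y) s, beyond b (median y) (tnth y i), `|median y - t| <= d * s).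
pose phi (a : {set 'I_n} * bool * bool) : R :=
  if [&& i \in a.1.1, a.1.2 & a.2] then #|a.1.1|%:R^-1 else 0.
rewrite (_ : fdp_share _ _ _ _ _ _ = phi \o f)//.
apply: measurable_finite_fun => -[[S b1] b2].
rewrite (_ : [set y | _] = [set y | BH alpha y (median y) s = S] `&`
  [set y | beyond b (median y) (tnth y i) = b1] `&`
  [set y | (`|median y - t| <= d * s) = b2]); last first.
  by apply/seteqP; split=> y /=; rewrite /f; [case=> -> -> ->|case=> [[-> ->] ->]].
have mbool (X : n.-tuple R -> bool) (c : bool) : measurable [set y | X y] ->
    measurable [set y | X y = c].
  case: c => // mX; rewrite (_ : [set y | _] = ~` [set y | X y]); first exact: measurableC.
  by apply/seteqP; split=> y /=; [move=> ->|move/negP/negbTE].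
apply: measurableI; first apply: measurableI.
- by apply: measurable_BH => //; exact: measurable_median.
- by apply: mbool; exact: measurable_beyond_median.
- apply: mbool; rewrite (_ : [set y | _] = ~` [set y | d * s < `|median y - t|]).
    by apply: measurableC; exact: measurable_median_deviation.
  by apply/seteqP; split=> y /=; rewrite leNgt => /negP.
Qed.

(** Over the values of the coordinate [i] for which the share does not vanish,
    the median and the set [S] of rejections are constant, and these values lie
    in a window of nominal probability [alpha * #|S| / n / 2]: the two factors
    [#|S|] cancel.
*)
Lemma integral_fdp_share n (alpha t s d : R) b (i : 'I_n) y :
  (1 < n)%N -> n%:R^-1 < alpha < 1 -> 0 < s -> 0 <= d <= 1 ->
  (\int[normal_law t s]_v (fdp_share alpha t s d b i (tuple_update y i v))%:E
   <= (tail_ratio n d * (alpha / n%:R / 2))%:E)%E.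
Proof.
move=> n1 /andP[an a1] s0 d01.
have n0' : (0 < n)%N by apply: ltn_trans n1.
have n0 : 0 < n%:R :> R by rewrite ltr0n.
have a0 : 0 < alpha by rewrite (lt_trans _ an)// invr_gt0.
have a01 : 0 < alpha <= 1 by rewrite a0 ltW.
pose C v := [&& i \in BH alpha (tuple_update y i v) (median (tuple_update y i v)) s,
  beyond b (median (tuple_update y i v)) v & `|median (tuple_update y i v) - t| <= d * s].
have FE v : fdp_share alpha t s d b i (tuple_update y i v) =
   if C v then #|BH alpha (tuple_update y i v) (median (tuple_update y i v)) s|%:R^-1 else 0.
  by rewrite /fdp_share tnth_tuple_update eqxx.
have tr0 : 0 <= tail_ratio n d by rewrite addr_ge0 ?expR_ge0 ?invr_ge0 ?ltW.
have [[v0 Cv0]|nC] := pselect (exists v, C v); last first.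
  rewrite (eq_integral (fun=> 0%E)).
    by rewrite integral0 lee_fin mulr_ge0// !divr_ge0// ltW.
  move=> v _; rewrite FE; case: ifPn => // Cv.
  by exfalso; apply: nC; exists v.
set x := median (tuple_update y i v0); set S := BH alpha (tuple_update y i v0) x s.
have [iS bx xt] : [/\ i \in S, beyond b x v0 & `|x - t| <= d * s] by exact/and3P.
have stab v : C v -> [/\ median (tuple_update y i v) = x, BH alpha (tuple_update y i v) x s = S & beyond b x v].
  move=> /and3P[iSv bv xtv].
  have ex : median (tuple_update y i v) = x by apply: (median_update_beyond (b := b)).
  rewrite ex in iSv bv; split; [exact: ex| |exact: bv].
  apply: (@BH_stable R n alpha (tuple_update y i v) (tuple_update y i v0) x x s i a01 _ iSv iS).
  by move=> j ji; rewrite /pvalue !tnth_tuple_update (negbTE ji).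
clearbody S x; have S0 : (0 < #|S|)%N by apply/card_gt0P; exists i.
have S0R : 0 < #|S|%:R :> R by rewrite ltr0n.
have Sn : #|S|%:R <= n%:R :> R by rewrite ler_nat -[X in (_ <= X)%N]card_ord max_card.
pose c := alpha * #|S|%:R / n%:R.
have cb : (2 * n%:R ^+ 2)^-1 <= c <= 1.
  apply/andP; split; last first.
    by rewrite /c ler_pdivrMr// mul1r -[leRHS]mul1r ler_pM// ltW.
  apply: (@le_trans _ _ (n%:R^-1 / n%:R)).
    rewrite -invfM lef_pV2 ?posrE ?mulr_gt0 ?exprn_gt0// expr2.
    by rewrite -[leLHS]mul1r ler_wpM2r ?mulr_ge0 ?ltW// ltr1n.
  rewrite ler_wpM2r ?invr_ge0 ?(ltW n0)// -[leLHS]mulr1 ler_pM ?invr_ge0 ?(ltW n0)//.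
    exact: ltW.
  by rewrite ler1n.
have [W mW [hW nW]] := rejection_window b n1 s0 d01 xt cb.
apply: (@le_trans _ _ (\int[normal_law t s]_v ((#|S|%:R^-1)%:E * (\1_W v)%:E))%E).
  apply: ge0_le_integral => //.
  - by move=> v _; rewrite lee_fin fdp_share_ge0.
  - by apply/measurable_EFinP; apply: (measurableT_comp (measurable_fdp_share _ _ _ _ _ a01)); exact: measurable_tuple_update.
  - by apply: measurable_funeM; apply/measurable_EFinP; exact: measurable_indic.
  - move=> v _; rewrite -EFinM lee_fin FE; case: ifPn => [Cv|_]; last by rewrite mulr_ge0.
    have [ex eS bxv] := stab _ Cv; have /and3P[iSv _ _] := Cv.
    rewrite ex in iSv; rewrite ex eS indicE mem_set; first by rewrite mulr1.
    apply: hW; first exact: bxv.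
    have := self_consistent_BH a0 iSv; rewrite eS -/c /pvalue tnth_tuple_update eqxx.
    exact.
rewrite ge0_integralZl//; last by apply/measurable_EFinP; exact: measurable_indic.
rewrite integral_indic// setIT.
apply: (le_trans (lee_wpmul2l _ nW)); first by rewrite lee_fin.
rewrite -EFinM lee_fin le_eqVlt; apply/orP; left; apply/eqP.
by rewrite /c; field; rewrite ?gt_eqF.
Qed.


Lemma FDP_le1 n (P : model n) S : FDP P S <= 1.
Proof.
rewrite /FDP ler_pdivrMr ?ltr0n ?leq_max ?orbT// mul1r ler_nat.
by rewrite (leq_trans (subset_leq_card (finset.subsetIl _ _)))// leq_maxl.
Qed.

Lemma BH_neq n (alpha : R) (y : n.-tuple R) u s i : 0 < alpha < 1 ->
  i \in BH alpha y u s -> tnth y i != u.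
Proof.
move=> /andP[a0 a1] iS; have := self_consistent_BH a0 iS; apply: contraTN => /eqP yi.
rewrite /pvalue yi subrr normr0 mul0r upper_tail0 -ltNge.
have n0 : (0 < n)%N by apply: leq_ltn_trans (ltn_ord i).
have n0R : 0 < n%:R :> R by rewrite ltr0n.
have Sn : #|BH alpha y u s|%:R <= n%:R :> R.
  by rewrite ler_nat -[X in (_ <= X)%N]card_ord max_card.
rewrite mulfV ?pnatr_eq0// ltr_pdivrMr// mul1r.
rewrite (le_lt_trans (ler_wpM2l (ltW a0) Sn))// -[ltRHS]mul1r ltr_pM2r//.
Qed.

(** A rejected coordinate differs from the median, since its p-value is less
    than 1, so its contribution is counted on exactly one side.
*)
Lemma FDP_le_shares n (P : model n) (alpha d : R) y : 0 < alpha < 1 ->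
  FDP P (BH alpha y (median y) (sigma P)) <=
  \sum_(i in H0 P) (fdp_share alpha (theta P) (sigma P) d true i y +
                    fdp_share alpha (theta P) (sigma P) d false i y) +
  \1_[set y : n.-tuple R | d * sigma P < `|median y - theta P|] y.
Proof.
move=> a01; have sh0 b i := @fdp_share_ge0 n alpha (theta P) (sigma P) d b i y.
rewrite indicE; case: (boolP (y \in _)) => [_|ybad].
  by rewrite (le_trans (FDP_le1 _ _))// lerDr sumr_ge0// => i _; rewrite addr_ge0.
have {}ybad : `|median y - theta P| <= d * sigma P.
  by rewrite leNgt; apply/negP => h; move/negP: ybad; apply; rewrite inE.
rewrite addr0 /FDP; set S := BH _ _ _ _.
rewrite (_ : #|S :&: H0 P|%SET%:R = \sum_(i in H0 P) (i \in S)%:R); last first.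
  rewrite -sum1_card natr_sum big_mkcond [RHS]big_mkcond; apply: eq_bigr => i _.
  by rewrite finset.in_setI; case: (i \in S); case: (i \in H0 P).
rewrite mulr_suml; apply: ler_sum => i _.
case: (boolP (i \in S)) => iS; last by rewrite mul0r addr_ge0.
have S0 : (0 < #|S|)%N by apply/card_gt0P; exists i.
rewrite mul1r (maxn_idPl S0) /fdp_share -/S iS ybad /= !andbT.
have := BH_neq a01 iS; rewrite neq_lt => /orP[h|h]; rewrite h lt_gtF//.
  by rewrite add0r.
by rewrite addr0.
Qed.

Lemma FDR_plugin_le n (P : model n) (alpha d : R) : (1 < n)%N -> in_model P ->
  n%:R^-1 < alpha < 1 -> 0 <= d <= 1 ->
  (FDR P (fun y s => BH alpha y (median y) s) <= (tail_ratio n d * alpha)%:E +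
   product_law P [set y | (d * sigma P < `|median y - theta P|)%R])%E.
Proof.
move=> n1 Pm an1 d01; have /andP[an a1] := an1.
have n0 : 0 < n%:R :> R by rewrite ltr0n (ltn_trans _ n1).
have a0 : 0 < alpha by rewrite (lt_trans _ an)// invr_gt0.
have a01 : 0 < alpha <= 1 by rewrite a0 ltW.
have s0 := sigma_gt0 Pm.
have tr0 : 0 <= tail_ratio n d by rewrite addr_ge0 ?expR_ge0 ?invr_ge0 ?ltW.
set bad := [set y | _].
have mbad : measurable bad by exact: measurable_median_deviation.
pose F b (i : 'I_n) y := fdp_share alpha (theta P) (sigma P) d b i y.
have mF b i : measurable_fun setT (fun y => (F b i y)%:E).
  by apply/measurable_EFinP; exact: measurable_fdp_share.
have F0 b i y : (0 <= (F b i y)%:E)%E by rewrite lee_fin fdp_share_ge0.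
have IF b i : i \in H0 P ->
    (\int[product_law P]_y (F b i y)%:E <= (tail_ratio n d * (alpha / n%:R / 2))%:E)%E.
  move=> iH; apply: (integral_le_resample (i := i)) => //.
    by rewrite lee_fin mulr_ge0// !divr_ge0// ltW.
  move=> y; rewrite (@eq_measure_integral _ _ _ _
    (normal_law (theta P) (sigma P))).
    exact: integral_fdp_share.
  by move=> A mA _; exact: (H0P iH).
rewrite /FDR unlock.
apply: (@le_trans _ _ (\int[product_law P]_y
  (\sum_(i <- enum (H0 P)) ((F true i y)%:E + (F false i y)%:E) + (\1_bad y)%:E))%E).
  apply: ge0_le_integral => //.
  - by move=> y _; rewrite lee_fin divr_ge0.
  - apply/measurable_EFinP.
    apply: (measurable_finite_fun (f := fun y => BH alpha y (median y) (sigma P)) (FDP P)).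
    by move=> S; apply: measurable_BH => //; exact: measurable_median.
  - apply: emeasurable_funD; last by apply/measurable_EFinP; exact: measurable_indic.
    by apply: emeasurable_sum => i; apply: emeasurable_funD; exact: mF.
  - move=> y _; have := @FDP_le_shares n P alpha d y; rewrite a0 a1 => /(_ isT).
    rewrite -lee_fin => /le_trans; apply; rewrite EFinD -sumEFin big_enum.
    by rewrite leeD2r//; apply: lee_sum => i _; rewrite EFinD.
rewrite ge0_integralD//; last 3 first.
- by move=> y _; apply: sume_ge0 => i _; rewrite adde_ge0.
- by apply: emeasurable_sum => i; apply: emeasurable_funD; exact: mF.
- by apply/measurable_EFinP; exact: measurable_indic.
rewrite integral_indic// setIT leeD2r//.
rewrite ge0_integral_sum// ?big_enum; last 2 first.
- by move=> i; apply: emeasurable_funD; exact: mF.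
- by move=> i y _; rewrite adde_ge0.
apply: (@le_trans _ _ (\sum_(i in H0 P) (tail_ratio n d * (alpha / n%:R))%:E)%E).
  apply: lee_sum => i iH; rewrite ge0_integralD//.
  apply: (le_trans (leeD (IF _ _ iH) (IF _ _ iH))).
  by rewrite -EFinD lee_fin le_eqVlt; apply/orP; left; apply/eqP; field; rewrite gt_eqF.
rewrite sumEFin lee_fin sumr_const -[leLHS]mulr_natr.
have hH : #|H0 P|%:R <= n%:R :> R by rewrite ler_nat -[X in (_ <= X)%N]card_ord max_card.
by rewrite -mulrA ler_wpM2l// mulrAC ler_pdivrMr// ler_wpM2l// ltW.
Qed.

(** A set that is self-consistent for the oracle p-values at the smaller level is
    self-consistent for the plug-in p-values at level [alpha]: the latter exceed
    the former by a factor at most [tail_ratio n d], and the slack [eta] in the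
    level absorbs it.
*)
Lemma BH_oracle_sub n (alpha eta d t s : R) (y : n.-tuple R) : (1 < n)%N ->
  n%:R^-1 < alpha < 1 -> 0 <= eta <= 2^-1 -> 0 <= d <= 1 -> 0 < s ->
  (1 - eta) * tail_ratio n d <= 1 -> `|median y - t| <= d * s ->
  BH (alpha * (1 - eta)) y t s \subset BH alpha y (median y) s.
Proof.
move=> n1 /andP[an a1] /andP[eta0 eta1] d01 s0 hr hm.
have n0 : 0 < n%:R :> R by rewrite ltr0n (ltn_trans _ n1).
have a0 : 0 < alpha by rewrite (lt_trans _ an)// invr_gt0.
have e0 : 0 < 1 - eta by lra.
apply: BH_sub; [by rewrite mulr_gt0|by rewrite a0 ltW|].
move=> j r /andP[r0 rn]; set c := alpha * (1 - eta) * r%:R / n%:R.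
have r1 : 1 <= r%:R :> R by rewrite ler1n.
have rnR : r%:R <= n%:R :> R by rewrite ler_nat.
have c0 : (2 * n%:R ^+ 2)^-1 <= c.
  rewrite (_ : (2 * n%:R ^+ 2)^-1 = n%:R^-1 * 2^-1 * 1 / n%:R); last by field; rewrite gt_eqF.
  rewrite ler_wpM2r ?invr_ge0 ?(ltW n0)// ler_pM ?mulr_ge0 ?invr_ge0 ?(ltW n0)//.
  by rewrite ler_pM ?invr_ge0 ?(ltW n0) ?(ltW an)//; lra.
have cpos : 0 < c by rewrite (lt_le_trans _ c0)// invr_gt0 mulr_gt0 ?exprn_gt0.
have c1 : c <= 1.
  rewrite /c ler_pdivrMr// mul1r -[leRHS]mul1r ler_pM ?mulr_ge0 ?(ltW a0) ?(ltW e0)//.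
  by rewrite -[leRHS]mulr1 ler_pM ?(ltW a0) ?(ltW e0) ?(ltW a1)//; lra.
have [|z z0 zc] := @upper_tail_quantile R (c / 2).
  by apply/andP; split; [rewrite divr_gt0|lra].
have hz : upper_tail (z - d) <= tail_ratio n d * (c / 2).
  rewrite -zc; apply: upper_tail_ratio => //; rewrite zc.
  have -> : (4 * n%:R ^+ 2)^-1 = (2 * n%:R ^+ 2)^-1 / 2 :> R by field; rewrite gt_eqF.
  by rewrite ler_wpM2r.
rewrite /pvalue mulrC -ler_pdivlMr// -zc upper_tail_leE => hw.
have hw' : z - d <= `|tnth y j - median y| / s.
  move: hw; rewrite !ler_pdivlMr// mulrBl => hw.
  by have := ler_distD (median y) (tnth y j) t; lra.
rewrite (le_trans (ler_wpM2l _ (le_upper_tail hw')))//.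
rewrite (le_trans (ler_wpM2l _ hz))//.
rewrite (_ : 2 * _ = (1 - eta) * tail_ratio n d * (alpha * r%:R / n%:R)); last first.
  by rewrite /c; field; rewrite gt_eqF.
by rewrite ler_piMl// divr_ge0// ?mulr_ge0// ltW.
Qed.

End upper_bound.

(** * The sparse regime *)
Section asymptotics.
Context {R : realType}.
Notation model n := ('I_n -> probability R R).

Lemma limn_esup_le (u : nat -> \bar R) (l : \bar R) (N : nat) :
  (forall n, (N <= n)%N -> (u n <= l)%E) -> (limn_esup u <= l)%E.
Proof.
move=> h; rewrite /limn_esup limf_esupE.
apply: (@le_trans _ _ (ereal_sup (u @` [set n | (N <= n)%N]))).
  apply: ereal_inf_lbound; exists [set n | (N <= n)%N] => //.
  by exists N.
by apply: ub_ereal_sup => _ [n /= Nn <-]; exact: h.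
Qed.

Definition fourth_root_inv (n : nat) : R := (Num.sqrt (Num.sqrt n%:R))^-1.

Lemma fourth_root_inv_ge0 n : 0 <= fourth_root_inv n.
Proof. by rewrite invr_ge0. Qed.

Lemma fourth_root_inv_gt0 n : (0 < n)%N -> 0 < fourth_root_inv n.
Proof. by move=> n0; rewrite invr_gt0 !sqrtr_gt0 ltr0n. Qed.

Lemma fourth_root_inv_sqr n : (0 < n)%N -> n%:R * fourth_root_inv n ^+ 2 = Num.sqrt n%:R.
Proof.
move=> n0; rewrite exprVn sqr_sqrtr ?sqrtr_ge0//.
have s0 : 0 < Num.sqrt (n%:R : R) by rewrite sqrtr_gt0 ltr0n.
by rewrite -[X in X / _ = _](@sqr_sqrtr _ n%:R)// expr2 mulfK// gt_eqF.
Qed.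

Lemma fourth_root_inv_cvg : fourth_root_inv @ \oo --> (0 : R).
Proof.
apply/gtr0_cvgV0.
  by near=> n; rewrite !sqrtr_gt0 ltr0n; near: n; exists 1%N.
apply/cvgryPge => A; near=> n.
apply: (@le_trans _ _ `|A|); first exact: ler_norm.
rewrite -[`|A|]sqrtr_sqr ler_wsqrtr// -[X in X <= _]ger0_norm ?sqr_ge0// -sqrtr_sqr ler_wsqrtr//.
by near: n; exact: nbhs_infty_ger.
Unshelve. all: by end_near. Qed.

(** Because [ln t^-1 <= t^-1] for [t = n ^ (-1/4)]; so [n ^ (-1/4)] is still
    negligible with respect to [1 / sqrt (ln n)].
*)
Lemma ln_fourth_root n : (0 < n)%N ->
  (fourth_root_inv n * Num.sqrt (ln n%:R)) ^+ 2 <= 4 * fourth_root_inv n :> R.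
Proof.
move=> n0; have t0 := fourth_root_inv_gt0 n0; have t2 := fourth_root_inv_sqr n0.
have n0R : 0 < n%:R :> R by rewrite ltr0n.
set t := fourth_root_inv n in t0 t2 *.
rewrite exprMn sqr_sqrtr ?ln_ge0 ?ler1n//.
have nt : n%:R = t^-1 ^+ 4 :> R.
  by rewrite /t /fourth_root_inv invrK (exprM _ 2 2) sqr_sqrtr ?sqrtr_ge0// sqr_sqrtr.
have ti0 : 0 < t^-1 by rewrite invr_gt0.
rewrite nt lnXn// -mulr_natl.
have : ln t^-1 <= t^-1 by rewrite ltW// ln_sublinear.
have tt : t ^+ 2 * t^-1 = t by rewrite expr2 mulfK// gt_eqF.
move=> h; have := ler_wpM2l (sqr_ge0 t) h; rewrite tt; lra.
Qed.

Variable k : nat -> R.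

(** The smallest [d] allowed by [median_deviation] with [tau = n ^ (-1/4)].  The
    absolute value keeps it nonnegative for the small [n] at which nothing is
    known about [k].
*)
Definition median_precision n : R :=
  (`|k n| / n%:R + 4 * fourth_root_inv n) / normal_pdf 0 1 1.

Definition tail_inflation n : R := tail_ratio n (median_precision n).

(** The term [n.+1^-1] makes the slack positive at every [n], including [0].
*)
Definition level_slack n : R := tail_inflation n - 1 + n.+1%:R^-1.

Lemma median_precision_ge0 n : 0 <= median_precision n.
Proof.
by rewrite divr_ge0 ?normal_pdf_ge0// addr_ge0// ?divr_ge0// mulr_ge0// fourth_root_inv_ge0.
Qed.

Lemma tail_inflation_ge1 n : 1 <= tail_inflation n.
Proof.
rewrite /tail_inflation /tail_ratio -[leLHS]addr0 lerD// ?invr_ge0//.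
rewrite -[leLHS]expR0 ler_expR mulr_ge0 ?median_precision_ge0//.
Qed.

Lemma level_slack_gt0 n : 0 < level_slack n.
Proof. by rewrite ltr_wpDl ?subr_ge0 ?tail_inflation_ge1// invr_gt0. Qed.

Hypothesis hk : (fun n => k n * Num.sqrt (ln n%:R) / n%:R) =o_\oo (fun=> 1 : R).

Lemma sparsity_cvg : (fun n => `|k n * Num.sqrt (ln n%:R) / n%:R|) @ \oo --> (0 : R).
Proof.
apply/cvgrPdist_le => e e0; near=> n; rewrite sub0r normrN normr_id.
have : `|k n * Num.sqrt (ln n%:R) / n%:R| <= e * `|1 : R|.
  by near: n; move/eqoP : hk; apply.
by rewrite normr1 mulr1.
Unshelve. all: by end_near. Qed.

(** The only place where the sparsity of [k] enters.
*)
Lemma precision_log_cvg :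
  (fun n => median_precision n * (4 * Num.sqrt (ln n%:R) + 1)) @ \oo --> (0 : R).
Proof.
pose c : R := normal_pdf 0 1 1; have c0 : 0 < c := normal_pdf01_gt0 _.
pose s n := `|k n * Num.sqrt (ln n%:R) / n%:R|.
apply: (@squeeze_cvgr _ _ _ _ (fun=> 0)
  (fun n => (5 * s n + 20 * Num.sqrt (4 * fourth_root_inv n)) / c)).
- near=> n; rewrite mulr_ge0 ?median_precision_ge0 ?addr_ge0 ?mulr_ge0//=.
  have n0 : (0 < n)%N by near: n; exists 1%N.
  have n0R : 0 < n%:R :> R by rewrite ltr0n.
  have l1 : 1 <= Num.sqrt (ln (n%:R : R)).
    rewrite -[leLHS]sqrtr1 ler_wsqrtr// -[leLHS]expRK ler_ln ?posrE ?expR_gt0//.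
    by near: n; exact: nbhs_infty_ger.
  set l := Num.sqrt (ln (n%:R : R)) in l1 *; have l0 : 0 <= l := sqrtr_ge0 _.
  rewrite /median_precision mulrAC ler_wpM2r ?invr_ge0 ?(ltW c0)//.
  apply: (@le_trans _ _ ((`|k n| / n%:R + 4 * fourth_root_inv n) * (5 * l))).
    rewrite ler_wpM2l// ?addr_ge0 ?mulr_ge0 ?divr_ge0 ?fourth_root_inv_ge0//.
    by lra.
  have hs : `|k n| / n%:R * l = s n.
    by rewrite /s !normrM normfV (ger0_norm (sqrtr_ge0 _)) (gtr0_norm n0R) mulrAC.
  have ht : fourth_root_inv n * l <= Num.sqrt (4 * fourth_root_inv n).
    rewrite -[leLHS]ger0_norm ?mulr_ge0 ?fourth_root_inv_ge0//.
    by rewrite -sqrtr_sqr ler_wsqrtr// ln_fourth_root.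
  rewrite (_ : (`|k n| / n%:R + 4 * fourth_root_inv n) * (5 * l) = 5 * (`|k n| / n%:R * l) + 20 * (fourth_root_inv n * l)); last by ring.
  by rewrite hs lerD2l ler_wpM2l.
- exact: cvg_cst.
- rewrite -[X in _ --> X](_ : (5 * 0 + 20 * Num.sqrt (4 * 0)) / c = 0); last first.
    by rewrite !mulr0 sqrtr0 mulr0 addr0 mul0r.
  apply: cvgMl; apply: cvgD; apply: cvgMr; first exact: sparsity_cvg.
  apply: (cvg_comp (fun n => 4 * fourth_root_inv n) (@Num.sqrt R)).
    by apply: cvgMr; exact: fourth_root_inv_cvg.
  exact: sqrt_continuous.
Unshelve. all: by end_near. Qed.

Lemma invn_cvg : (fun n => n%:R^-1) @ \oo --> (0 : R).
Proof.
apply/gtr0_cvgV0; first by near=> n; rewrite ltr0n; near: n; exists 1%N.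
exact: cvgr_idn.
Unshelve. all: by end_near. Qed.

Lemma tail_inflation_cvg : tail_inflation @ \oo --> (1 : R).
Proof.
rewrite -[X in _ --> X](_ : expR 0 + 0 = 1); last by rewrite expR0 addr0.
apply: cvgD; last exact: invn_cvg.
apply: (cvg_comp _ (@expR R)); first exact: precision_log_cvg.
exact: continuous_expR.
Qed.

Lemma level_slack_cvg : level_slack @ \oo --> (0 : R).
Proof.
rewrite -[X in _ --> X](_ : 1 - 1 + 0 = 0 :> R); last by rewrite subrr addr0.
apply: cvgD; last by rewrite (cvg_shiftS (fun n => n%:R^-1 : R^o)); exact: invn_cvg.
by apply: cvgB; [exact: tail_inflation_cvg|exact: cvg_cst].
Qed.

Lemma median_precision_le1 : \forall n \near \oo, median_precision n <= 1.
Proof.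
near=> n; apply: (@le_trans _ _ (median_precision n * (4 * Num.sqrt (ln n%:R) + 1))).
  by rewrite -[leLHS]mulr1 ler_wpM2l ?median_precision_ge0// lerDr mulr_ge0.
near: n; apply: (cvgr_le _ precision_log_cvg); exact: ltr01.
Unshelve. all: by end_near. Qed.

Hypothesis k_sparse : forall n, (2 < n)%N -> 1 <= k n < n%:R / 2.

Lemma median_precise : \forall n \near \oo, forall P : model n,
  sparse_model (k n) P ->
  (product_law P [set y | (median_precision n * sigma P < `|median y - theta P|)%R]
    <= (2 * fourth_root_inv n ^+ 2)%:E)%E.
Proof.
near=> n => P [Pm n1P].
have n0 : (0 < n)%N by near: n; exists 1%N.
have n0R : 0 < n%:R :> R by rewrite ltr0n.
have d1 : median_precision n <= 1 by near: n; exact: median_precision_le1.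
have t0 := fourth_root_inv_gt0 n0.
have t1 : fourth_root_inv n <= 2^-1.
  by near: n; apply: (cvgr_le _ fourth_root_inv_cvg); rewrite invr_gt0.
apply: (le_trans (@median_deviation R n P (k n) (fourth_root_inv n) _ n0 Pm n1P _ _ _)).
- by rewrite t0.
- by rewrite median_precision_ge0.
- rewrite /median_precision [normal_pdf 0 1 1 * _]mulrC divfK ?gt_eqF ?normal_pdf01_gt0//.
  by rewrite [leRHS]mulrDl divfK ?gt_eqF// lerD2r ler_norm.
- rewrite lee_fin ler_wpM2l// fourth_root_inv_sqr// expRN.
  have s0 : 0 < Num.sqrt (n%:R : R) by rewrite sqrtr_gt0 ltr0n.
  rewrite exprVn sqr_sqrtr ?sqrtr_ge0// lef_pV2 ?posrE ?expR_gt0//.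
  by apply: le_trans (expR_ge1Dx _); rewrite lerDr.
Unshelve. all: by end_near. Qed.

Lemma deviation_bound_cvg : (fun n => 2 * fourth_root_inv n ^+ 2) @ \oo --> (0 : R).
Proof.
rewrite -[X in _ --> X](_ : 2 * (0 * 0) = 0 :> R); last by rewrite !mulr0.
by apply: cvgMr; apply: cvgM; exact: fourth_root_inv_cvg.
Qed.

Lemma measurable_TDP_lt n (P : model n) (f g : n.-tuple R -> {set 'I_n}) :
  (forall S, measurable [set y | f y = S]) -> (forall S, measurable [set y | g y = S]) ->
  measurable [set y | TDP P (f y) < TDP P (g y)].
Proof.
move=> mf mg; pose h y : {set 'I_n} * {set 'I_n} := (f y, g y).
apply: (@measurable_finite_image _ _ _ h [set a | TDP P a.1 < TDP P a.2]) => -[S T].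
rewrite (_ : [set y | _] = [set y | f y = S] `&` [set y | g y = T]); last first.
  by apply/seteqP; split=> y /=; rewrite /h; [by case=> -> <-|by case=> -> <-].
exact: measurableI.
Qed.

Lemma TDP_subset n (P : model n) (S T : {set 'I_n}) :
  S \subset T -> TDP P S <= TDP P T.
Proof.
move=> ST; rewrite /TDP; apply: ler_wpM2r; first by rewrite invr_ge0.
by rewrite ler_nat; apply: subset_leq_card; apply: finset.setSI.
Qed.

Theorem median_BH_AMO : AMO (fun n alpha y s => BH alpha y (median y) s) k.
Proof.
split.
  move=> n alpha /andP[a0 a1] s S s0; apply: measurable_BH; last exact: measurable_median.
  by rewrite a0 ltW.
exists level_slack; first by split; [exact: level_slack_gt0|exact: level_slack_cvg].
have d1 := median_precision_le1.
split.
- apply/lee_addgt0Pr => e e0; rewrite add0e.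
  have : \forall n \near \oo, [/\ (1 < n)%N, median_precision n <= 1,
      tail_inflation n <= 1 + e / 2, 2 * fourth_root_inv n ^+ 2 <= e / 2 &
      forall P : model n, sparse_model (k n) P -> (product_law P
        [set y | (median_precision n * sigma P < `|median y - theta P|)%R] <=
        (2 * fourth_root_inv n ^+ 2)%:E)%E].
    near=> n; split.
    + by near: n; exists 2%N.
    + by near: n.
    + by near: n; apply: (cvgr_le _ tail_inflation_cvg); rewrite ltrDl divr_gt0.
    + by near: n; apply: (cvgr_le _ deviation_bound_cvg); rewrite divr_gt0.
    + by near: n; exact: median_precise.
  case=> N _ hN; apply: (@limn_esup_le _ _ N) => n /hN[n1 dn1 h1 h2 hP].
  apply: ub_ereal_sup => _ [alpha /andP[an a1] <-].
  have n0 : 0 < n%:R :> R by rewrite ltr0n (ltn_trans _ n1).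
  have a0 : 0 < alpha by rewrite (lt_trans _ an)// invr_gt0.
  rewrite leeBlDr//; apply: ub_ereal_sup => _ [P PS <-].
  apply: (le_trans (@FDR_plugin_le R n P alpha (median_precision n) n1 PS.1 _ _)).
  + by rewrite an/=; lra.
  + by rewrite median_precision_ge0.
  apply: (le_trans (leeD2l _ (hP _ PS))).
  rewrite -!EFinD lee_fin.
  have := ler_wpM2r (ltW a0) h1; rewrite -/(tail_inflation n).
  have : e / 2 * alpha <= e / 2 * 1 by rewrite ler_wpM2l ?divr_ge0 ?(ltW e0)//; lra.
  by lra.
- apply: (@squeeze_cvge _ _ _ _ (fun=> 0%E) _ (fun n => (2 * fourth_root_inv n ^+ 2)%:E)).
  + have : \forall n \near \oo, [/\ (2 < n)%N, median_precision n <= 1,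
        level_slack n <= 2^-1 & forall P : model n, sparse_model (k n) P ->
        (product_law P
          [set y | (median_precision n * sigma P < `|median y - theta P|)%R] <=
          (2 * fourth_root_inv n ^+ 2)%:E)%E].
      near=> n; split.
      * by near: n; exists 3%N.
      * by near: n.
      * by near: n; apply: (cvgr_le _ level_slack_cvg); rewrite invr_gt0.
      * by near: n; exact: median_precise.
    apply: filterS => n [n2 dn sl hP].
    have ngt1 : (1 < n)%N by exact: ltn_trans n2.
    have n0 : 0 < n%:R :> R by rewrite ltr0n (ltn_trans _ ngt1).
    have dn1 : 0 <= median_precision n <= 1 by rewrite median_precision_ge0.
    apply/andP; split.
    (* The supremum is nonnegative because the model without alternatives
       and the level 5/12 belong to the sets over which it is taken. *)
    * pose P0 : model n := fun=> normal_law 0 1.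
      have P0n : null_parameter P0 (0, 1).
        split=> //=; rewrite (_ : [set i | _]%SET = [set: 'I_n])%SET; last first.
          by apply/setP => i; rewrite !finset.in_set; apply/asboolP.
        by rewrite cardsT card_ord mul2n -addnn -[X in (X < _)%N]addn0 ltn_add2l (ltn_trans _ ngt1).
      have P0m : in_model P0 by exists (0, 1).
      have sp0 : sparse_model (k n) P0.
        split=> //; have [tP sP] := null_parameterE P0n.
        have -> : n1 P0 = 0%N.
          have := card_H0_n1 P0; rewrite /H0 tP sP.
          rewrite (_ : [set i | _]%SET = [set: 'I_n])%SET; last first.
            by apply/setP => i; rewrite !finset.in_set; apply/asboolP.
          by rewrite cardsT card_ord => /eqP; rewrite -[X in _ == X]addn0 eqn_add2l => /eqP.
        by have /andP[k1 _] := k_sparse n2; rewrite (le_trans _ k1).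
      have lr : level_range n (5/12 : R).
        apply/andP; split; last by lra.
        apply: (@le_lt_trans _ _ 3^-1); last by lra.
        by rewrite lef_pV2 ?posrE// ler_nat.
      apply: (@le_trans _ _ (risk_II (fun y s => BH (5/12) y (median y) s) (k n) (5/12 * (1 - level_slack n)))).
        apply: (@le_trans _ _ (product_law P0 [set y | TDP P0 (BH (5/12) y (median y) (sigma P0)) <
           TDP P0 (oracle_BH P0 (5/12 * (1 - level_slack n)) y)])) => //.
        by apply: ereal_sup_ubound; exists P0.
      by apply: ereal_sup_ubound; exists (5/12).
    * apply: ub_ereal_sup => _ [alpha /andP[an a1] <-].
      apply: ub_ereal_sup => _ [P PS <-].
      apply: (@le_trans _ _ (product_law P [set y | (median_precision n * sigma P < `|median y - theta P|)%R])); last first.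
        exact: hP.
      have a0 : 0 < alpha by rewrite (lt_trans _ an)// invr_gt0.
      have s0 := sigma_gt0 PS.1.
      have mu2 : measurable_fun setT (fun _ : n.-tuple R => theta P) by exact: measurable_cst.
      apply: le_measure.
      -- rewrite inE.
         apply: measurable_TDP_lt => S; [|rewrite /oracle_BH]; apply: measurable_BH => //.
         ++ by rewrite a0/=; lra.
         ++ exact: measurable_median.
         ++ have := level_slack_gt0 n; move: sl; set e := level_slack n => sl e0.
            by rewrite mulr_gt0 ?subr_gt0//=; [nra|lra].
      -- by rewrite inE; exact: measurable_median_deviation.
      -- move=> y /=; apply: contraPT; rewrite -leNgt => hm; apply/negP; rewrite -leNgt.
         apply: TDP_subset.
         apply: (@BH_oracle_sub R n alpha (level_slack n) (median_precision n)
           (theta P) (sigma P) y ngt1 _ _ dn1 s0 _ hm).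
         ++ by rewrite an/=; lra.
         ++ by rewrite (ltW (level_slack_gt0 n)) sl.
         ++ have e0 : 0 < n.+1%:R^-1 :> R by rewrite invr_gt0.
            have r1 := tail_inflation_ge1 n.
            rewrite -/(tail_inflation n) /level_slack.
            set r := tail_inflation n in r1 *; set e := _^-1 in e0 *.
            have : 0 <= (r - 1) ^+ 2 by exact: sqr_ge0.
            have : 0 <= e * r by rewrite mulr_ge0 ?(ltW e0)//; lra.
            by rewrite expr2; lra.
  + exact: cvg_cst.
  + by apply: cvg_EFin; [near=> m|exact: deviation_bound_cvg].
Unshelve. all: by end_near. Qed.

End asymptotics.

(** * Two contaminations with the same law *)
Section density_law.
Context {R : realType}.
Notation mu := (@lebesgue_measure R).

(** The proofs are arguments of the definition so that the probability structure
    can be inferred from the term.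
*)
Definition density_law (f : R -> R) (f0 : forall x, 0 <= f x)
    (mf : measurable_fun setT f)
    (f1 : (\int[mu]_(x in setT) (f x)%:E)%E = 1%E) : set R -> \bar R :=
  fun A => (\int[mu]_(x in A) (f x)%:E)%E.

Variables (f : R -> R) (f0 : forall x, 0 <= f x).
Variables (mf : measurable_fun setT f).
Variable (f1 : (\int[mu]_(x in setT) (f x)%:E)%E = 1%E).

Let density_law0 : density_law f0 mf f1 set0 = 0%E.
Proof. by rewrite /density_law integral_set0. Qed.

Let density_law_ge0 A : (0 <= density_law f0 mf f1 A)%E.
Proof. by apply: integral_ge0 => x _; rewrite lee_fin. Qed.

Let density_law_sigma_additive : semi_sigma_additive (density_law f0 mf f1).
Proof.
move=> A mA tA mUA; rewrite /density_law ge0_integral_bigcup//.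
- by apply: is_cvg_ereal_nneg_natsum_cond => n _ _; exact: density_law_ge0.
- by apply/measurable_EFinP; apply: measurable_funTS.
- by move=> x _; rewrite lee_fin.
Qed.

HB.instance Definition _ := isMeasure.Build _ _ _ (density_law f0 mf f1)
  density_law0 density_law_ge0 density_law_sigma_additive.

HB.instance Definition _ :=
  Measure_isProbability.Build _ _ _ (density_law f0 mf f1) f1.

End density_law.

Section gap.
Context {R : realType}.
Notation mu := (@lebesgue_measure R).
Implicit Types a b x : R.

Definition gap a b x : R := Num.max (normal_pdf b 1 x - normal_pdf a 1 x) 0.

Lemma gap_ge0 a b x : 0 <= gap a b x.
Proof. by rewrite le_max lexx orbT. Qed.

Lemma measurable_gap a b : measurable_fun setT (gap a b).
Proof.
apply: measurable_maxr => //.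
by apply: measurable_funB; exact: measurable_normal_pdf.
Qed.

(** Both sides are the pointwise maximum of the two densities.
*)
Lemma gap_swap a b x : normal_pdf a 1 x + gap a b x = normal_pdf b 1 x + gap b a x.
Proof.
rewrite /gap; have [h|h] := leP (normal_pdf a 1 x) (normal_pdf b 1 x).
  by rewrite (max_idPl _) ?subr_ge0// (max_idPr _) ?subr_le0//; ring.
by rewrite (max_idPr _) ?subr_le0 ?ltW// (max_idPl _) ?subr_ge0 ?ltW//; ring.
Qed.

Lemma measurable_gapE a b (A : set R) : measurable_fun A (fun x => (gap a b x)%:E).
Proof. by apply/measurable_EFinP; apply: measurable_funTS; exact: measurable_gap. Qed.

Lemma integral_pdf_gap a b (A : set R) : measurable A ->
  (\int[mu]_(x in A) ((normal_pdf a 1 x)%:E + (gap a b x)%:E) =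
   normal_law a 1 A + \int[mu]_(x in A) (gap a b x)%:E)%E.
Proof.
move=> mA; rewrite ge0_integralD//.
- by move=> x _; rewrite lee_fin normal_pdf_ge0.
- exact: measurable_EFin_normal_pdf.
- by move=> x _; rewrite lee_fin gap_ge0.
- exact: measurable_gapE.
Qed.

Lemma integral_gap_swap a b (A : set R) : measurable A ->
  (normal_law a 1 A + \int[mu]_(x in A) (gap a b x)%:E =
   normal_law b 1 A + \int[mu]_(x in A) (gap b a x)%:E)%E.
Proof.
move=> mA; rewrite -(integral_pdf_gap a b mA) -(integral_pdf_gap b a mA).
by apply: eq_integral => x _; rewrite -!EFinD gap_swap.
Qed.

Lemma gap_eq0 m x : 0 < m -> x <= m / 2 -> gap 0 m x = 0.
Proof.
move=> m0 xm; rewrite /gap (max_idPr _)// subr_le0 (normal_pdf_shift m).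
rewrite ler_piMr ?normal_pdf_ge0// -[leRHS]expR0 ler_expR.
have -> : m * x - m ^+ 2 / 2 = m * (x - m / 2) by field.
by rewrite pmulr_rle0// subr_le0.
Qed.

Lemma gap_swap_eq0 m x : 0 < m -> m / 2 <= x -> gap m 0 x = 0.
Proof.
move=> m0 xm; rewrite /gap (max_idPr _)// subr_le0 (normal_pdf_shift m).
rewrite ler_peMr ?normal_pdf_ge0// -[leLHS]expR0 ler_expR.
have -> : m * x - m ^+ 2 / 2 = m * (x - m / 2) by field.
by rewrite pmulr_rge0// subr_ge0.
Qed.

Lemma integral_gap_tail m x : 0 < m -> m / 2 <= x ->
  (\int[mu]_(t in `]x, +oo[) (gap 0 m t)%:E =
   (upper_tail (x - m) - upper_tail x)%:E)%E.
Proof.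
move=> m0 xm; have := @integral_gap_swap 0 m `]x, +oo[ (measurable_itv _).
rewrite [X in (_ = _ + X)%E -> _]integral0_eq; last first.
  move=> t; rewrite /= in_itv/= andbT => xt; rewrite gap_swap_eq0//.
  exact: le_trans (ltW xt).
rewrite /normal_law !normal_prob_gt// subr0 !divr1 adde0 EFinB => <-.
by rewrite addeAC subee// add0e.
Qed.

(** The total variation distance between [N(0, 1)] and [N(m, 1)].
*)
Definition separation m : R := upper_tail (- (m / 2)) - upper_tail (m / 2).

Lemma separation_gt0 m : 0 < m -> 0 < separation m.
Proof. by move=> m0; rewrite subr_gt0 lt_upper_tail//; lra. Qed.

Lemma separation_le m : 0 < m -> separation m <= m / 2.
Proof.
move=> m0; apply: (le_trans (upper_tailB_le _)); first by lra.
by lra.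
Qed.

Lemma integral_gap m : 0 < m -> (\int[mu]_(t in setT) (gap 0 m t)%:E = (separation m)%:E)%E.
Proof.
move=> m0; rewrite /separation -[in RHS](_ : m / 2 - m = - (m / 2)); last by field.
rewrite -integral_gap_tail// [RHS]integral_mkcond; apply: eq_integral => t _.
rewrite patchE; case: ifPn => //; rewrite notin_setE/= in_itv/= andbT => /negP.
by rewrite -leNgt => tm; rewrite gap_eq0.
Qed.

Lemma integral_gap_opp m : 0 < m -> (\int[mu]_(t in setT) (gap m 0 t)%:E = (separation m)%:E)%E.
Proof.
move=> m0; have := @integral_gap_swap 0 m setT measurableT.
have -> : normal_law 0 1 setT = 1%E := @probability_setT _ _ _ (normal_law 0 1).
have -> : normal_law m 1 setT = 1%E := @probability_setT _ _ _ (normal_law m 1).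
rewrite (integral_gap m0) => /(congr1 (fun z => z - 1)%E).
rewrite (addeAC 1%E (separation m)%:E) (addeAC 1%E (\int[mu]_t _)%E).
have -> : (1 - 1 = 0 :> \bar R)%E by rewrite subee.
by rewrite !add0e => <-.
Qed.

Variable m : R.
Hypothesis m0 : 0 < m.

Let d0 : 0 < separation m. Proof. exact: separation_gt0. Qed.

Lemma alt_pdf_ge0 a b x : 0 <= gap a b x / separation m.
Proof. by rewrite divr_ge0 ?gap_ge0// ltW. Qed.

Lemma measurable_alt_pdf a b : measurable_fun setT (fun x => gap a b x / separation m).
Proof. by apply: measurable_funM => //; exact: measurable_gap. Qed.

Lemma integral_alt_pdf a b (A : set R) : measurable A ->
  (\int[mu]_(t in A) (gap a b t / separation m)%:E =
   (\int[mu]_(t in A) (gap a b t)%:E) * ((separation m)^-1)%:E)%E.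
Proof.
move=> mA; under eq_integral do rewrite EFinM.
rewrite ge0_integralZr//.
- exact: measurable_gapE.
- by move=> x _; rewrite lee_fin gap_ge0.
- by rewrite lee_fin invr_ge0 ltW.
Qed.

Lemma integral_alt_pdf_right : (\int[mu]_(t in setT) (gap 0 m t / separation m)%:E = 1)%E.
Proof. by rewrite integral_alt_pdf// integral_gap// -EFinM divff ?gt_eqF. Qed.

Lemma integral_alt_pdf_left : (\int[mu]_(t in setT) (gap m 0 t / separation m)%:E = 1)%E.
Proof. by rewrite integral_alt_pdf// integral_gap_opp// -EFinM divff ?gt_eqF. Qed.

Definition right_law : probability R R :=
  density_law (alt_pdf_ge0 0 m) (measurable_alt_pdf 0 m) integral_alt_pdf_right.

Definition left_law : probability R R :=
  density_law (alt_pdf_ge0 m 0) (measurable_alt_pdf m 0) integral_alt_pdf_left.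

(** The proportion of alternatives for which the maximum of the two densities,
    normalized by its mass [1 + separation m], has null part [1 - contamination].
*)
Definition contamination : R := separation m / (1 + separation m).

Lemma mixture_pdf_ge0 x : 0 <= (normal_pdf 0 1 x + gap 0 m x) / (1 + separation m).
Proof.
by rewrite divr_ge0// addr_ge0 ?gap_ge0 ?normal_pdf_ge0 ?(ltW d0).
Qed.

Lemma measurable_mixture_pdf :
  measurable_fun setT (fun x => (normal_pdf 0 1 x + gap 0 m x) / (1 + separation m)).
Proof.
apply: measurable_funM => //; apply: measurable_funD; last exact: measurable_gap.
exact: measurable_normal_pdf.
Qed.

Lemma integral_mixture_pdf (A : set R) : measurable A ->
  (\int[mu]_(t in A) ((normal_pdf 0 1 t + gap 0 m t) / (1 + separation m))%:E =
   (normal_law 0 1 A + \int[mu]_(t in A) (gap 0 m t)%:E) * ((1 + separation m)^-1)%:E)%E.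
Proof.
move=> mA; under eq_integral do rewrite EFinM EFinD.
rewrite ge0_integralZr//.
- by rewrite integral_pdf_gap.
- by apply: emeasurable_funD; [exact: measurable_EFin_normal_pdf|exact: measurable_gapE].
- by move=> x _; rewrite -EFinD lee_fin addr_ge0 ?gap_ge0 ?normal_pdf_ge0.
- by rewrite lee_fin invr_ge0 addr_ge0// ltW.
Qed.

Lemma integral_mixture_pdf_setT :
  (\int[mu]_(t in setT) ((normal_pdf 0 1 t + gap 0 m t) / (1 + separation m))%:E = 1)%E.
Proof.
rewrite integral_mixture_pdf// integral_gap//.
have -> : normal_law 0 1 setT = 1%E := @probability_setT _ _ _ (normal_law 0 1).
by rewrite -EFinD -EFinM divff// gt_eqF// addr_gt0.
Qed.

Definition mixture_law : probability R R :=
  density_law mixture_pdf_ge0 measurable_mixture_pdf integral_mixture_pdf_setT.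

Let compl_contamination : 1 - contamination = (1 + separation m)^-1.
Proof. by rewrite /contamination; field; rewrite gt_eqF// addr_gt0. Qed.

Lemma mixture_law_right (A : set R) : measurable A ->
  (mixture_law A = contamination%:E * right_law A + (1 - contamination)%:E * normal_law 0 1 A)%E.
Proof.
move=> mA; rewrite compl_contamination.
rewrite [LHS]integral_mixture_pdf// [right_law A]integral_alt_pdf//.
rewrite muleDl//; last first.
  rewrite ge0_adde_def// inE; first exact: measure_ge0.
  by apply: integral_ge0 => x _; rewrite lee_fin gap_ge0.
rewrite addeC [(normal_law 0 1 A * _)%E]muleC; congr (_ + _)%E.
rewrite muleA [(contamination%:E * _)%E]muleC -muleA -EFinM; congr (_ * _)%E.
by rewrite /contamination; congr EFin; field; rewrite !gt_eqF// addr_gt0.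
Qed.

Lemma mixture_law_left (A : set R) : measurable A ->
  (mixture_law A = contamination%:E * left_law A + (1 - contamination)%:E * normal_law m 1 A)%E.
Proof.
move=> mA; rewrite compl_contamination.
rewrite [LHS]integral_mixture_pdf// integral_gap_swap// [left_law A]integral_alt_pdf//.
rewrite muleDl//; last first.
  rewrite ge0_adde_def// inE; first exact: measure_ge0.
  by apply: integral_ge0 => x _; rewrite lee_fin gap_ge0.
rewrite addeC [(normal_law m 1 A * _)%E]muleC; congr (_ + _)%E.
rewrite muleA [(contamination%:E * _)%E]muleC -muleA -EFinM; congr (_ * _)%E.
by rewrite /contamination; congr EFin; field; rewrite !gt_eqF// addr_gt0.
Qed.

Lemma right_law_tail x : m / 2 <= x ->
  (contamination%:E * right_law `]x, +oo[%classic =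
   ((upper_tail (x - m) - upper_tail x) / (1 + separation m))%:E)%E.
Proof.
move=> mx; rewrite [right_law _]integral_alt_pdf// integral_gap_tail//.
rewrite -!EFinM; congr EFin; rewrite /contamination.
by field; rewrite !gt_eqF// addr_gt0.
Qed.

Lemma right_law0 : right_law `]-oo, m / 2]%classic = 0%E.
Proof.
rewrite [LHS]integral_alt_pdf// integral0_eq ?mul0e// => x.
by rewrite /= in_itv/= => xm; rewrite gap_eq0.
Qed.

Lemma left_law0 : left_law `]m / 2, +oo[%classic = 0%E.
Proof.
rewrite [LHS]integral_alt_pdf// integral0_eq ?mul0e// => x.
by rewrite /= in_itv/= andbT => xm; rewrite gap_swap_eq0// ltW.
Qed.

Lemma contamination_ge0_le1 : 0 <= contamination <= 1.
Proof.
have h : 0 < 1 + separation m by rewrite addr_gt0.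
by rewrite /contamination divr_ge0 ?ltW//= ltr_pdivrMr// mul1r ltrDr.
Qed.

Lemma contamination_le : contamination <= m / 2.
Proof.
apply: le_trans (separation_le m0).
have h : 0 < 1 + separation m by rewrite addr_gt0.
by rewrite /contamination ler_pdivrMr// mulrDr mulr1 lerDl mulr_ge0// ltW.
Qed.

End gap.

(** * Averaging over random labels *)
Section label_average.
Context {R : realType}.
Variable p : R.
Hypothesis p01 : 0 <= p <= 1.
Implicit Types F G : (nat -> bool) -> \bar R.

Let p0 : 0 <= p. Proof. by case/andP: p01. Qed.
Let q0 : 0 <= 1 - p. Proof. by rewrite subr_ge0; case/andP: p01. Qed.

(** The labels telling which coordinates are alternatives are functions on [nat],
    so that removing the first coordinate does not change their type.
*)
Definition label_cons (t : bool) (b : nat -> bool) : nat -> bool :=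
  fun j => if j is j'.+1 then b j' else t.

(** The expectation of [F] over independent Bernoulli labels of parameter [p]; only
    the first [n] labels are drawn.
*)
Fixpoint label_avg n F : \bar R :=
  if n is m.+1 then (p%:E * label_avg m (fun b => F (label_cons true b)) +
                     (1 - p)%:E * label_avg m (fun b => F (label_cons false b)))%E
  else F (fun=> false).

Lemma label_avg_le n F G : (forall b, F b <= G b)%E -> (label_avg n F <= label_avg n G)%E.
Proof.
elim: n F G => [|n IH] F G FG //=.
by apply: leeD; apply: lee_wpmul2l; rewrite ?lee_fin ?p0 ?q0//; apply: IH => b; exact: FG.
Qed.

Lemma label_avg_ge0 n F : (forall b, 0 <= F b)%E -> (0 <= label_avg n F)%E.
Proof.
elim: n F => [|n IH] F F0 //=.
by apply: adde_ge0; apply: mule_ge0; rewrite ?lee_fin ?p0 ?q0//; apply: IH => b; exact: F0.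
Qed.

Lemma label_avg_cst n (c : R) : label_avg n (fun=> c%:E) = c%:E.
Proof.
elim: n => [//|n /= ->]; rewrite -!EFinM -EFinD; congr EFin; ring.
Qed.

Lemma label_avgD n F G : (forall b, 0 <= F b)%E -> (forall b, 0 <= G b)%E ->
  (label_avg n (fun b => F b + G b) = label_avg n F + label_avg n G)%E.
Proof.
elim: n F G => [|n IH] F G F0 G0 //=.
rewrite !IH//; try by move=> b; rewrite ?F0 ?G0.
rewrite !ge0_muleDr ?label_avg_ge0//; try by move=> b; rewrite ?F0 ?G0.
by rewrite addeACA.
Qed.

Definition labels_count n (b : nat -> bool) : nat := \sum_(i < n) b i.

Lemma label_avg_count n (c d : R) :
  label_avg n (fun b => (c + d * (labels_count n b)%:R)%:E) = (c + d * (n%:R * p))%:E.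
Proof.
elim: n c => [|n IH] c /=; first by rewrite /labels_count big_ord0 mul0r.
have e t : label_avg n (fun b => (c + d * (labels_count n.+1 (label_cons t b))%:R)%:E) =
    label_avg n (fun b => ((c + d * t%:R) + d * (labels_count n b)%:R)%:E).
  congr label_avg; apply/funext => b; congr EFin.
  by rewrite /labels_count big_ord_recl/= natrD mulrDr addrA.
rewrite !e !IH -!EFinM -EFinD; congr EFin; rewrite -[n.+1%:R]natr1 /= mulr1n mulr0n; ring.
Qed.

Lemma label_avg_prod n (u : R) :
  label_avg n (fun b => (\prod_(i < n) (if b i then u else 1))%:E) = ((1 - p + p * u) ^+ n)%:E.
Proof.
have main c : label_avg n (fun b => (c * \prod_(i < n) (if b i then u else 1))%:E) =
    (c * (1 - p + p * u) ^+ n)%:E.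
  elim: n c => [|n IH] c /=; first by rewrite big_ord0 expr0.
  have e (t : bool) : label_avg n (fun b => (c * \prod_(i < n.+1) (if label_cons t b i then u else 1))%:E) =
      label_avg n (fun b => ((c * (if t then u else 1)) * \prod_(i < n) (if b i then u else 1))%:E).
    congr label_avg; apply/funext => b; congr EFin.
    by rewrite big_ord_recl/= mulrA.
  rewrite !e !IH -!EFinM -EFinD; congr EFin; rewrite exprS; ring.
by have := main 1; rewrite mul1r => <-; congr label_avg; apply/funext => b; rewrite mul1r.
Qed.

Variables A1 A0 M : probability R R.
Hypothesis mixE : forall B, measurable B -> (M B = p%:E * A1 B + (1 - p)%:E * A0 B)%E.

Definition labelled n (b : nat -> bool) : 'I_n -> probability R R :=
  fun i => if b i then A1 else A0.

Lemma integral_mixture (H : R -> \bar R) : measurable_fun setT H ->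
  (forall x, 0 <= H x)%E ->
  (\int[M]_x H x = p%:E * \int[A1]_x H x + (1 - p)%:E * \int[A0]_x H x)%E.
Proof.
move=> mH H0.
pose p' : {nonneg R} := NngNum p0; pose q' : {nonneg R} := NngNum q0.
rewrite (eq_measure_integral (measure_add (mscale p' A1) (mscale q' A0))); last first.
  by move=> B mB _; rewrite [RHS]measure_addE; exact: (mixE mB).
rewrite ge0_integral_measure_add//.
by rewrite !ge0_integral_mscale.
Qed.

(** Drawing the labels first and then the data from the labelled model amounts to
    drawing every coordinate from the mixture.  Integrating the first coordinate
    first lets the induction go through without exchanging the average with an
    integral.
*)
Lemma label_avg_product_law n (G : n.-tuple R -> \bar R) : measurable_fun setT G ->
  (forall y, 0 <= G y)%E ->
  label_avg n (fun b => \int[product_law (labelled b)]_y G y)%E =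
  (\int[product_law (fun _ : 'I_n => M)]_y G y)%E.
Proof.
elim: n G => [|n IH] G mG G0 //.
rewrite integral_product_lawS_swap//.
have step (A : probability R R) (t : bool) : A = (if t then A1 else A0) ->
    label_avg n (fun b => \int[product_law (@labelled n.+1 (label_cons t b))]_y G y)%E =
    (\int[product_law (fun _ : 'I_n => M)]_y \int[A]_z G (tuple_cons (z, y)))%E.
  move=> eA; rewrite -IH; last 2 first.
  - exact: measurable_integral_head.
  - by move=> y; apply: integral_ge0.
  congr label_avg; apply/funext => b; rewrite integral_product_lawS_swap// eA.
  by congr (integral _ _ _); case: (t).
rewrite /= (step A1 true)// (step A0 false)//.
pose h (A : probability R R) y := (\int[A]_z G (tuple_cons (z, y)))%E.
have mh A : measurable_fun setT (h A) by exact: measurable_integral_head.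
have h0 A y : (0 <= h A y)%E by exact: integral_ge0.
transitivity (\int[product_law (fun _ : 'I_n => M)]_y
   (p%:E * h A1 y + (1 - p)%:E * h A0 y))%E.
  rewrite [RHS]ge0_integralD//; last 4 first.
  - by move=> y _; rewrite mule_ge0// lee_fin.
  - exact: measurable_funeM.
  - by move=> y _; rewrite mule_ge0// lee_fin.
  - exact: measurable_funeM.
  by rewrite !ge0_integralZl// lee_fin.
apply: eq_integral => y _; rewrite integral_mixture//.
apply: (@measurableT_comp _ _ _ _ _ _ G _ (fun z => tuple_cons (z, y)) mG).
apply: (@measurableT_comp _ _ _ _ _ _ (@tuple_cons R n) _ (fun z => (z, y))).
  exact: measurable_tuple_cons.
exact: measurable_pair2.
Qed.

End label_average.

(** * The dense regime *)
Section lower_bound.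
Context {R : realType}.
Notation model n := ('I_n -> probability R R).

Lemma card_labels n (b : nat -> bool) : #|[set i : 'I_n | b i]%SET| = labels_count n b.
Proof.
rewrite /labels_count -sum1_card big_mkcond; apply: eq_bigr => i _.
by rewrite finset.in_set; case: (b i).
Qed.

Lemma labelled_null n (A1 : probability R R) t b : (2 * labels_count n b < n)%N ->
  null_parameter (@labelled R A1 (normal_law t 1) n b) (t, 1).
Proof.
move=> hb; split=> //=.
have hc : (n - labels_count n b <=
    #|[set i | `[< gaussian_at (@labelled R A1 (normal_law t 1) n b) t 1 i >]]%SET|)%N.
  have -> : (n - labels_count n b)%N = #|~: [set i : 'I_n | b i]%SET|.
    have := cardsC [set i : 'I_n | b i]%SET; rewrite card_ord -card_labels => e.
    by rewrite -[X in (X - _)%N]e addKn.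
  apply: subset_leq_card.
  apply/fintype.subsetP => i; rewrite finset.in_setC finset.in_set => /negbTE nb.
  by rewrite finset.in_set; apply/asboolP; rewrite /gaussian_at /labelled nb.
rewrite (leq_trans _ (leq_mul (leqnn 2) hc))// mulnBr ltn_subRL.
by rewrite [(2 * n)%N]mul2n -addnn ltn_add2r.
Qed.

Lemma labelled_nulls n (A1 : probability R R) t b : (2 * labels_count n b < n)%N ->
  ~: [set i : 'I_n | b i]%SET \subset H0 (@labelled R A1 (normal_law t 1) n b).
Proof.
move=> hb; have [tE sE] := null_parameterE (labelled_null A1 t hb).
apply/fintype.subsetP => i; rewrite finset.in_setC finset.in_set => /negbTE nb.
by rewrite finset.in_set tE sE; apply/asboolP; rewrite /gaussian_at /labelled nb.
Qed.

Lemma labelled_sparse n (A1 : probability R R) t b (k : R) : k < n%:R / 2 ->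
  (labels_count n b)%:R <= k ->
  (2 * labels_count n b < n)%N /\ sparse_model k (@labelled R A1 (normal_law t 1) n b).
Proof.
move=> kn bk; have hb : (2 * labels_count n b < n)%N.
  rewrite -(ltr_nat R) natrM mulrC -ltr_pdivlMr//.
  exact: le_lt_trans kn.
split=> //; split; first by exists (t, 1); exact: labelled_null.
apply: le_trans bk; rewrite ler_nat -card_labels /n1 /H1.
by apply: subset_leq_card; rewrite finset.subCset labelled_nulls.
Qed.

(** The proportion of rejections that fall in [B]: a quantity computed from the
    data, without the labels.
*)
Definition share n (B : set R) (S : {set 'I_n}) (y : n.-tuple R) : R :=
  #|[set i in S | tnth y i \in B]%SET|%:R / (maxn #|S| 1)%:R.

Lemma share_ge0 n B S (y : n.-tuple R) : 0 <= share B S y.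
Proof. by rewrite /share divr_ge0. Qed.

Lemma share_le1 n B S (y : n.-tuple R) : share B S y <= 1.
Proof.
rewrite /share ler_pdivrMr ?ltr0n ?leq_max ?orbT// mul1r ler_nat.
rewrite (leq_trans _ (leq_maxl _ _))//; apply: subset_leq_card.
by apply/fintype.subsetP => i; rewrite finset.in_set => /andP[].
Qed.

Lemma share_compl n B S (y : n.-tuple R) : S != finset.set0 ->
  share B S y + share (~` B) S y = 1.
Proof.
move=> S0; have c0 : (0 < #|S|)%N by rewrite card_gt0.
rewrite /share (maxn_idPl c0) -mulrDl -natrD.
rewrite (_ : (_ + _)%N = #|S|) ?divff ?pnatr_eq0 -?lt0n//.
rewrite -(cardsID [set i | tnth y i \in B]%SET S); congr (_ + _)%N; apply: eq_card => i.
  by rewrite !finset.inE.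
by rewrite !finset.inE in_setC andbC.
Qed.

Lemma measurable_share n B (f : n.-tuple R -> {set 'I_n}) : measurable B ->
  (forall S, measurable [set y | f y = S]) ->
  measurable_fun setT (fun y => (share B (f y) y)%:E).
Proof.
move=> mB mf; apply/measurable_EFinP.
pose g (y : n.-tuple R) : {set 'I_n} * {set 'I_n} := (f y, [set i | tnth y i \in B]%SET).
pose phi (a : {set 'I_n} * {set 'I_n}) : R := #|a.1 :&: a.2|%:R / (maxn #|a.1| 1)%:R.
rewrite (_ : (fun y => _) = phi \o g).
  apply: measurable_finite_fun => -[S T].
  rewrite (_ : [set y | _] = [set y | f y = S] `&`
      [set y | [set i | tnth y i \in B]%SET = T]); last first.
    by apply/seteqP; split=> y /=; rewrite /g; [case=> -> <-|case=> -> <-].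
  apply: measurableI => //; apply: measurable_bool_set => i.
  rewrite (_ : [set y | _] = [set y | B (tnth y i)]); first exact: measurable_set_tnth.
  by apply/seteqP; split=> y /=; rewrite inE.
apply/funext => y; rewrite /share /phi /g /=; congr (_%:R / _).
by apply: eq_card => i; rewrite !finset.inE.
Qed.

(** Alternatives do not fall in [B], so almost surely every rejection in [B] is
    false.
*)
Lemma integral_share_le_FDR n (A1 : probability R R) t b (Rej : procedure n) (B : set R) :
  measurable B -> A1 B = 0%E ->
  (forall S, measurable [set y : n.-tuple R | Rej y 1 = S]) ->
  (2 * labels_count n b < n)%N ->
  (\int[product_law (@labelled R A1 (normal_law t 1) n b)]_y (share B (Rej y 1) y)%:E
    <= FDR (@labelled R A1 (normal_law t 1) n b) Rej)%E.
Proof.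
move=> mB A1B mRej hb; set P := labelled _ _ _.
have [tE sE] := null_parameterE (labelled_null A1 t hb).
have H0P := labelled_nulls A1 t hb.
rewrite /FDR -/P sE unlock.
pose h (i : 'I_n) (y : n.-tuple R) : \bar R := (if b i then \1_B (tnth y i) else 0)%:E.
have h0 i y : (0 <= h i y)%E by rewrite /h; case: (b i); rewrite lee_fin.
have mh i : measurable_fun setT (h i).
  rewrite /h; case: (b i); last exact: measurable_cst.
  apply/measurable_EFinP; apply: (@measurableT_comp _ _ _ _ _ _ (\1_B : R -> R)).
    exact: measurable_indic.
  exact: measurable_tnth.
have mFDP : measurable_fun setT (fun y => (FDP P (Rej y 1))%:E).
  apply/measurable_EFinP.
  exact: (measurable_finite_fun (f := fun y => Rej y 1) (FDP P)).
have FDP0 S : 0 <= FDP P S by rewrite /FDP divr_ge0.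
apply: (@le_trans _ _ (\int[product_law P]_y
    ((FDP P (Rej y 1))%:E + \sum_(i <- enum 'I_n) h i y))%E).
  apply: ge0_le_integral => //.
  - by move=> y _; rewrite lee_fin share_ge0.
  - exact: measurable_share.
  - by apply: emeasurable_funD => //; exact: emeasurable_sum.
  - move=> y _; have [[i bi yi]|nD] := pselect (exists2 i : 'I_n, b i & B (tnth y i)).
      apply: (@le_trans _ _ 1%E); first by rewrite lee_fin share_le1.
      apply: (@le_trans _ _ (h i y)); first by rewrite /h bi indicE mem_set.
      rewrite (big_rem i) ?mem_enum//=.
      rewrite addeCA leeDl// adde_ge0 ?lee_fin//; apply: sume_ge0 => *; exact: h0.
    rewrite (le_trans _ (leeDl _ _))//; last by apply: sume_ge0 => *; exact: h0.
    rewrite lee_fin /share /FDP; apply: ler_wpM2r; first by rewrite invr_ge0.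
    rewrite ler_nat; apply: subset_leq_card; apply/fintype.subsetP => i.
    rewrite finset.in_set finset.in_setI => /andP[-> /=]; rewrite inE => yi.
    apply: (fintype.subsetP H0P); rewrite finset.in_setC finset.in_set.
    by apply/negP => bi; apply: nD; exists i.
rewrite ge0_integralD//; last 3 first.
- by move=> y _; rewrite lee_fin.
- by move=> y _; apply: sume_ge0 => *; exact: h0.
- exact: emeasurable_sum.
rewrite ge0_integral_sum//.
rewrite [X in (_ + X)%E]big1 ?adde0// => i _.
rewrite /h; case: (boolP (b i)) => bi; last by rewrite integral0.
rewrite (eq_integral (fun y => (\1_[set y : n.-tuple R | B (tnth y i)] y)%:E)).
  rewrite integral_indic// ?setIT; last exact: measurable_set_tnth.
  by rewrite [LHS](product_law_marginal P i mB) /P /labelled bi.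
by move=> y _; rewrite !indicE; congr ((_ _)%:R%:E); apply/idP/idP; rewrite !inE.
Qed.

(** The bound on the risk concerns the labels with at most [k] alternatives only;
    the others are handled by Markov's inequality, [k^-1] times the number of
    alternatives being at least 1 for them.
*)
Lemma label_avg_share_le n (p : R) (A1 M : probability R R) t (Rej : procedure n) (B : set R) (k r : R) :
  0 <= p <= 1 -> 0 < k < n%:R / 2 -> 0 <= r ->
  (forall C, measurable C -> (M C = p%:E * A1 C + (1 - p)%:E * normal_law t 1 C)%E) ->
  measurable B -> A1 B = 0%E ->
  (forall S, measurable [set y : n.-tuple R | Rej y 1 = S]) ->
  (risk_I Rej k <= r%:E)%E ->
  (\int[product_law (fun _ : 'I_n => M)]_y (share B (Rej y 1) y)%:E
    <= (r + k^-1 * (n%:R * p))%:E)%E.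
Proof.
move=> p01 /andP[k0 kn] r0 mixE mB A1B mRej hr.
rewrite -(label_avg_product_law p01 mixE); last 2 first.
- exact: measurable_share.
- by move=> y; rewrite lee_fin share_ge0.
rewrite -label_avg_count; apply: label_avg_le => // b.
have [bk|bk] := leP (labels_count n b)%:R k.
  have [hb sp] := labelled_sparse A1 t kn bk.
  apply: (le_trans (integral_share_le_FDR t mB A1B mRej hb)).
  apply: (@le_trans _ _ r%:E); last by rewrite lee_fin lerDl mulr_ge0// invr_ge0 ltW.
  apply: le_trans hr; apply: ereal_sup_ubound.
  by exists (labelled A1 (normal_law t 1) b).
apply: (@le_trans _ _ 1%E).
  rewrite -[leRHS](integral_cst_probability (product_law (@labelled R A1 (normal_law t 1) n b))).
  apply: ge0_le_integral => //.
  - by move=> y _; rewrite lee_fin share_ge0.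
  - exact: measurable_share.
  - by move=> y _; rewrite lee_fin share_le1.
rewrite lee_fin (@le_trans _ _ (k^-1 * (labels_count n b)%:R))//.
  by rewrite mulrC ler_pdivlMr// mul1r ltW.
by rewrite lerDr.
Qed.

Lemma no_alternative_probability n (A1 A0 : probability R R) b (x u : R) :
  A1 `]-oo, x]%classic = u%:E ->
  product_law (@labelled R A1 A0 n b) [set y | forall i : 'I_n, b i -> tnth y i <= x] =
  (\prod_(i < n) (if b i then u else 1))%:E.
Proof.
move=> Au; pose B (i : 'I_n) : set R := if b i then `]-oo, x]%classic else setT.
rewrite (_ : [set y | _] = [set y | forall i, B i (tnth y i)]); last first.
  apply/seteqP; split=> y /= h i; have := h i; rewrite /B; case: (b i) => //=.
  by move=> /(_ isT); rewrite in_itv.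
rewrite product_lawE; last by move=> i; rewrite /B; case: (b i).
rewrite (eq_bigr (fun i : 'I_n => ((if b i then u else 1)%:E))).
  by rewrite prodEFin.
move=> i _; rewrite /B /labelled; case: (b i) => //.
exact: probability_setT.
Qed.

(** An alternative beyond [x] passes the Bonferroni threshold.  The set [B] only
    serves to tell the law of the alternatives from the null law.
*)
Lemma oracle_rejects n (A1 : probability R R) b (alpha x : R)
    (y : n.-tuple R) (i : 'I_n) (B : set R) :
  (2 * labels_count n b < n)%N -> 0 < alpha <= 1 -> 0 <= x ->
  2 * upper_tail x <= alpha / n%:R -> measurable B -> A1 B <> normal_prob 0 1 B ->
  b i -> x < tnth y i ->
  0 < TDP (@labelled R A1 (normal_law 0 1) n b)
    (oracle_BH (@labelled R A1 (normal_law 0 1) n b) alpha y).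
Proof.
move=> hb a01 x0 hx mB A1B bi xy; set P := labelled _ _ _.
have [tE sE] := null_parameterE (labelled_null A1 0 hb).
have iH1 : i \in H1 P.
  rewrite /H1 finset.in_setC; apply/negP => /H0P /(_ _ mB).
  by rewrite tE sE /P /labelled bi.
have iO : i \in oracle_BH P alpha y.
  rewrite /oracle_BH tE sE; apply: bonferroni_BH => //.
  rewrite /pvalue subr0 divr1 gtr0_norm ?(le_lt_trans x0)//.
  by rewrite (le_trans _ hx)// ler_wpM2l// le_upper_tail// ltW.
rewrite /TDP divr_gt0// ltr0n ?leq_max ?orbT// card_gt0.
by apply/finset.set0Pn; exists i; rewrite finset.in_setI iO.
Qed.

(** Unless the procedure is less powerful than the oracle, or no alternative lies
    beyond [x], or there are too many alternatives, something is rejected, and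
    then the two shares add up to 1.
*)
Lemma labelled_detection n (A1 : probability R R) (Rej : procedure n) (B : set R)
    (k alpha x u e : R) b :
  0 < k < n%:R / 2 -> 0 < alpha <= 1 -> 0 <= x -> 0 <= e ->
  2 * upper_tail x <= alpha / n%:R -> measurable B -> A1 B = 0%E -> normal_prob 0 1 B <> 0%E ->
  (forall S, measurable [set y : n.-tuple R | Rej y 1 = S]) ->
  A1 `]-oo, x]%classic = u%:E ->
  (risk_II Rej k alpha <= e%:E)%E ->
  (1 <= \int[product_law (@labelled R A1 (normal_law 0 1) n b)]_y
      ((share B (Rej y 1) y)%:E + (share (~` B) (Rej y 1) y)%:E)
    + ((e + k^-1 * (labels_count n b)%:R)%:E +
       (\prod_(i < n) (if b i then u else 1))%:E))%E.
Proof.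
move=> /andP[k0 kn] a01 x0 e0 hx mB A1B NB mRej Au hr.
set P := labelled _ _ _.
have mBc : measurable (~` B) by exact: measurableC.
pose s y : \bar R := ((share B (Rej y 1) y)%:E + (share (~` B) (Rej y 1) y)%:E)%E.
have s0 y : (0 <= s y)%E by rewrite /s -EFinD lee_fin addr_ge0 ?share_ge0.
have ms : measurable_fun setT s by apply: emeasurable_funD; exact: measurable_share.
rewrite [X in (X + _)%E](_ : _ = (\int[product_law P]_y s y)%E)//.
have is0 : (0 <= \int[product_law P]_y s y)%E by apply: integral_ge0 => y _; exact: s0.
have u0 : 0 <= u by rewrite -lee_fin -Au.
have pr0 : (0 <= (\prod_(i < n) (if b i then u else 1))%:E)%E.
  by rewrite lee_fin prodr_ge0// => i _; case: (b i).
have [bk|bk] := leP (labels_count n b)%:R k; last first.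
  apply: (@le_trans _ _ (e + k^-1 * (labels_count n b)%:R)%:E); last first.
    by rewrite addeCA leeDl// adde_ge0.
  rewrite lee_fin (@le_trans _ _ (k^-1 * (labels_count n b)%:R))//.
    by rewrite mulrC ler_pdivlMr// mul1r ltW.
  by rewrite lerDr.
have [hb sp] := labelled_sparse A1 0 kn bk.
have [tE sE] := null_parameterE (labelled_null A1 0 hb).
pose T := [set y : n.-tuple R | TDP P (Rej y 1) < TDP P (oracle_BH P alpha y)].
pose N := [set y : n.-tuple R | forall i : 'I_n, b i -> tnth y i <= x].
have mT : measurable T.
  apply: measurable_TDP_lt => // S; rewrite /oracle_BH.
  by apply: (measurable_BH (u := fun=> theta P)) => //; exact: measurable_cst.
have mN : measurable N.
  rewrite (_ : N = \bigcap_(i in [set: 'I_n]) [set y : n.-tuple R |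
      (if b i then `]-oo, x]%classic else setT) (tnth y i)]).
    apply: fin_bigcap_measurable => // i _; apply: measurable_set_tnth.
    by case: (b i).
  apply/seteqP; split=> y /= h i; have := h i; case: (b i) => //=.
    by rewrite in_itv/= => + _; exact.
  by rewrite in_itv/= => + _; exact.
have PT : (product_law P T <= e%:E)%E.
  apply: le_trans hr; apply: ereal_sup_ubound; exists P => //.
  by rewrite sE.
have PN : product_law P N = (\prod_(i < n) (if b i then u else 1))%:E.
  exact: no_alternative_probability.
apply: (@le_trans _ _ (\int[product_law P]_y (s y + ((\1_T y)%:E + (\1_N y)%:E)))%E).
  rewrite -[leLHS](integral_cst_probability (product_law P)).
  apply: ge0_le_integral => //.
  - apply: emeasurable_funD => //; apply: emeasurable_funD;
      apply/measurable_EFinP; exact: measurable_indic.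
  - move=> y _; rewrite !indicE.
    have [yT|/negP yT] := boolP (y \in T).
      by rewrite addeCA leeDl// adde_ge0// lee_fin.
    have [yN|/negP yN] := boolP (y \in N).
      by rewrite add0e leeDr.
    rewrite !adde0 /s -EFinD share_compl//.
    apply/eqP => R0; apply: yN; rewrite inE => i bi; rewrite leNgt; apply/negP => xy.
    apply: yT; rewrite inE /T /= R0 {1}/TDP finset.set0I cards0 mul0r.
    apply: (oracle_rejects hb a01 x0 hx mB) bi xy.
    by rewrite A1B => h; exact: NB.
have mI (C : set (n.-tuple R)) : measurable C ->
    measurable_fun setT (fun y => (\1_C y)%:E : \bar R).
  by move=> mC; apply/measurable_EFinP; exact: measurable_indic.
have I0 (C : set (n.-tuple R)) y : (0 <= (\1_C y)%:E :> \bar R)%E by rewrite lee_fin.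
rewrite (ge0_integralD _ measurableT (fun y _ => s0 y) ms
  (fun y _ => adde_ge0 (I0 T y) (I0 N y)) (emeasurable_funD (mI T mT) (mI N mN))).
rewrite (ge0_integralD _ measurableT (fun y _ => I0 T y) (mI T mT)
  (fun y _ => I0 N y) (mI N mN)).
rewrite !integral_indic// !setIT; apply: leeD => //; apply: leeD; last by rewrite [leLHS]PN.
by rewrite (le_trans PT)// lee_fin lerDl mulr_ge0// invr_ge0 ltW.
Qed.

(** [labelled_detection] averaged over the labels in the first reading, where the
    two shares integrate to at most [r] each: the first one by the bound on the
    risk in the first reading, the second one by the bound in the second reading,
    since both readings have the same law.
*)
Lemma mimicking_tradeoff n (Rej : procedure n) (k alpha m x r e : R) :
  (forall S, measurable [set y : n.-tuple R | Rej y 1 = S]) ->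
  0 < k < n%:R / 2 -> 0 < alpha <= 1 -> 0 < m -> m / 2 <= x ->
  2 * upper_tail x <= alpha / n%:R -> 0 <= r -> 0 <= e ->
  (risk_I Rej k <= r%:E)%E -> (risk_II Rej k alpha <= e%:E)%E ->
  1 <= 2 * r + e + 3 * (k^-1 * (n%:R * contamination m)) +
    (1 - (upper_tail (x - m) - upper_tail x) / (1 + separation m)) ^+ n.
Proof.
move=> mRej hk a01 m0 mx hx r0 e0 hI hII.
have x0 : 0 <= x by rewrite (le_trans _ mx)// divr_ge0// ltW.
set p := contamination m; have p01 : 0 <= p <= 1 by exact: contamination_ge0_le1.
pose B : set R := `]-oo, m / 2]%classic.
have mB : measurable B by exact: measurable_itv.
have BC : ~` B = `]m / 2, +oo[%classic by rewrite setCitvl.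
pose u := fine (right_law m0 `]-oo, x]%classic).
have Au : right_law m0 `]-oo, x]%classic = u%:E by rewrite fineK// fin_num_measure.
have mixR := mixture_law_right m0; have mixL := mixture_law_left m0.
set M := mixture_law m0 in mixR mixL.
have NB : normal_prob 0 1 B <> 0%E.
  rewrite normal_prob_le// => -[] /eqP; rewrite gt_eqF// upper_tail_gt0.
  done.
have h1 := label_avg_share_le p01 hk r0 mixR mB (right_law0 m0) mRej hI.
have h2 := label_avg_share_le p01 hk r0 mixL (measurableC mB) _ mRej hI.
have {}h2 := h2 (etrans (congr1 _ BC) (left_law0 m0)).
have qE : 1 - p + p * u = 1 - (upper_tail (x - m) - upper_tail x) / (1 + separation m).
  have := right_law_tail m0 mx.
  rewrite -setCitvl probability_setC// [X in (1 - X)%E]Au -EFinB -EFinM => -[] <-.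
  by rewrite -/p; ring.
have pw b := labelled_detection b hk a01 x0 e0 hx mB (right_law0 m0) NB mRej Au hII.
have := label_avg_le p01 n pw; rewrite label_avg_cst.
have u0 : 0 <= u by rewrite -lee_fin -Au.
have s0 y : (0 <= (share B (Rej y 1) y)%:E + (share (~` B) (Rej y 1) y)%:E)%E.
  by rewrite -EFinD lee_fin addr_ge0 ?share_ge0.
have k0 : 0 < k by case/andP: hk.
rewrite label_avgD//; last 2 first.
- by move=> b; apply: integral_ge0.
- move=> b; rewrite -EFinD lee_fin !addr_ge0// ?mulr_ge0 ?invr_ge0 ?(ltW k0)//.
  by rewrite prodr_ge0// => i _; case: (b i).
rewrite (label_avg_product_law p01 mixR)//; last first.
  by apply: emeasurable_funD; apply: measurable_share => //; exact: measurableC.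
rewrite label_avgD//; last 2 first.
- by move=> b; rewrite lee_fin addr_ge0// mulr_ge0// invr_ge0 ltW.
- by move=> b; rewrite lee_fin prodr_ge0// => i _; case: (b i).
rewrite label_avg_count label_avg_prod qE ge0_integralD//; last 4 first.
- by move=> y _; rewrite lee_fin share_ge0.
- exact: measurable_share.
- by move=> y _; rewrite lee_fin share_ge0.
- by apply: measurable_share => //; exact: measurableC.
move=> h; have := le_trans h (leeD2r _ (leeD h1 h2)).
by rewrite -!EFinD lee_fin; lra.
Qed.


Lemma limn_esup_near_le (u : nat -> \bar R) (e : R) : (limn_esup u <= 0)%E -> 0 < e ->
  \forall n \near \oo, (u n <= e%:E)%E.
Proof.
move=> hu e0; have : (limn_esup u < e%:E)%E by rewrite (le_lt_trans hu).
rewrite /limn_esup limf_esupE => /ereal_inf_lt[_ [V VF <-]] hV.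
apply: filterS VF => n Vn; apply: (le_trans _ (ltW hV)).
by apply: ereal_sup_ubound; exists n.
Qed.

Lemma normal_peak1_ge : 16^-1 <= normal_peak 1 :> R.
Proof.
have h : (1 ^+ 2 * pi *+ 2 : R) <= 16 ^+ 2.
  by rewrite expr1n mul1r mulr2n; have := pihalf_lt2 R; lra.
have h1 : Num.sqrt (1 ^+ 2 * pi *+ 2) <= 16 :> R.
  by rewrite -[leRHS]ger0_norm// -sqrtr_sqr ler_wsqrtr.
have h0 : 0 < Num.sqrt (1 ^+ 2 * pi *+ 2 : R).
  by rewrite sqrtr_gt0 expr1n mul1r mulr2n; have := pi_gt0 R; lra.
by rewrite /normal_peak lef_pV2 ?posrE.
Qed.

(** At [l = sqrt (ln n)] the tail is still larger than the Bonferroni level, as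
    [(l + 1) ^ 2 / 2 <= l ^ 2] for [l >= 3] and [n = expR (l ^ 2)].
*)
Lemma quantile_ge_sqrt_ln n (a x : R) : (0 < n)%N -> 3 <= Num.sqrt (ln n%:R : R) ->
  upper_tail x = a -> a <= (16 * n%:R)^-1 -> Num.sqrt (ln n%:R) <= x.
Proof.
move=> n0 l3 xa an; rewrite -upper_tail_leE xa (le_trans an)//.
have n0R : 0 < n%:R :> R by rewrite ltr0n.
have ln0 : 0 <= ln (n%:R : R) by rewrite ln_ge0// ler1n.
set l := Num.sqrt _ in l3 *.
have nE : n%:R = expR (l ^+ 2) :> R by rewrite sqr_sqrtr// lnK.
apply: le_trans (upper_tail_ge_pdf _); last by lra.
rewrite normal_pdfE ?oner_neq0// invfM ler_pM ?invr_ge0 ?(ltW n0R)//.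
  exact: normal_peak1_ge.
rewrite nE -expRN /normal_fun ler_expR subr0 expr1n mulNr lerN2.
have : 0 <= (l - 3) * (l + 1) by rewrite mulr_ge0//; lra.
by rewrite ler_pdivrMr// mulr2n; nra.
Qed.

Lemma pow_one_sub_le n (q c : R) : (0 < n)%N -> 0 <= q <= 1 -> 0 < c -> c / n%:R <= q ->
  (1 - q) ^+ n <= c^-1.
Proof.
move=> n0 /andP[q0 q1] c0 hq; have n0R : 0 < n%:R :> R by rewrite ltr0n.
apply: (@le_trans _ _ (expR (- q) ^+ n)).
  rewrite ler_pXn2r ?nnegrE ?expR_ge0 ?subr_ge0//.
  by have := expR_ge1Dx (- q).
rewrite -expRM_natl mulrN expRN lef_pV2 ?posrE ?expR_gt0//.
apply: le_trans (expR_ge1Dx _); move: hq; rewrite ler_pdivrMr// mulrC => /le_trans; apply.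
by rewrite lerDr.
Qed.

(** The lower bound on [k] gives [m * x - m ^+ 2 / 2 >= 255], hence at [x] the
    tail of [N(m, 1)] is at least 256 times the tail [alpha / (2 * n)] of
    [N(0, 1)].
*)
Lemma dense_regime_bounds n (k alpha x : R) : (0 < n)%N -> 0 < k < n%:R / 2 ->
  64 * 128 <= k * Num.sqrt (ln n%:R) / n%:R ->
  16^-1 <= alpha <= 8^-1 -> upper_tail x = alpha / n%:R / 2 ->
  let m := k / (32 * n%:R) in
  [/\ 0 < m, m / 2 <= x, k^-1 * (n%:R * contamination m) <= 64^-1 &
    (1 - (upper_tail (x - m) - upper_tail x) / (1 + separation m)) ^+ n <= 2^-1].
Proof.
move=> n0 /andP[k0 kn] hd /andP[a0 a1] hx m.
have n0R : 0 < n%:R :> R by rewrite ltr0n.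
set l := Num.sqrt (ln (n%:R : R)) in hd; have l0 : 0 <= l := sqrtr_ge0 _.
have m0 : 0 < m by rewrite divr_gt0// mulr_gt0.
have mkn : m = k / n%:R / 32 by rewrite /m; field; rewrite gt_eqF.
have kn2 : k / n%:R <= 2^-1 by rewrite ler_pdivrMr// mulrC ltW.
have m1 : m <= 64^-1 by rewrite mkn; lra.
have ml : 256 <= m * l.
  rewrite mkn -[X in _ <= X]mulrA [32^-1 * l]mulrC mulrA.
  by rewrite -[k / n%:R * l]mulrAC in hd *; lra.
have l3 : 3 <= l.
  have : m * l <= 64^-1 * l by rewrite ler_wpM2r.
  by lra.
have lx : l <= x.
  apply: (quantile_ge_sqrt_ln n0 l3 hx).
  rewrite -mulrA mulrC -mulrA invfM mulrC.
  have -> : 2^-1 * alpha / n%:R = n%:R^-1 * (alpha / 2) :> R by field; rewrite gt_eqF.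
  rewrite [leRHS]mulrC ler_wpM2l ?invr_ge0 ?(ltW n0R)//; lra.
have mx : m / 2 <= x by lra.
have s0 := separation_gt0 m0; have s1 := separation_le m0.
have hw : 255 <= m * x - m ^+ 2 / 2.
  have : m * l <= m * x by rewrite ler_wpM2l// ltW.
  have : m ^+ 2 <= 1 by rewrite -[leRHS](expr1n _ 2) ler_pXn2r ?nnegrE ?(ltW m0)//; lra.
  by lra.
split=> //.
  have := contamination_le m0; move=> hc.
  rewrite [_^-1 * _]mulrC ler_pdivrMr//.
  apply: (@le_trans _ _ (n%:R * (m / 2))); first by rewrite ler_wpM2l ?(ltW n0R).
  rewrite mkn le_eqVlt; apply/orP; left; apply/eqP; field; rewrite gt_eqF//.
have ht : 0 < upper_tail x := upper_tail_gt0 _.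
set d := upper_tail (x - m) - upper_tail x.
have d1 : d <= 1 by have := upper_tail_le1 (x - m); rewrite /d; lra.
have dw : 255 * upper_tail x <= d.
  have h := upper_tail_shift_ge x (ltW m0).
  have : (1 + 255) * upper_tail x <= expR (m * x - m ^+ 2 / 2) * upper_tail x.
    by rewrite ler_wpM2r ?(ltW ht)// (le_trans _ (expR_ge1Dx _))// lerD2l.
  by rewrite /d; lra.
have d0 : 0 <= d by move: dw; lra.
have hs2 : 0 < 1 + separation m by lra.
apply: pow_one_sub_le => //.
  rewrite divr_ge0 ?(ltW hs2)//= ler_pdivrMr// mul1r; lra.
rewrite ler_pdivlMr//.
apply: (@le_trans _ _ (4 / n%:R)).
  by rewrite mulrAC ler_wpM2r ?invr_ge0 ?(ltW n0R)//; lra.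
apply: le_trans dw; rewrite hx.
have -> : 255 * (alpha / n%:R / 2) = (255 / 2 * alpha) / n%:R :> R by field; rewrite gt_eqF.
by rewrite ler_wpM2r ?invr_ge0 ?(ltW n0R)//; lra.
Qed.

Theorem no_AMO_dense (k : nat -> R)
    (hk : forall n, (2 < n)%N -> 1 <= k n < n%:R / 2) :
  (fun=> 1 : R) =o_\oo (fun n => k n * Num.sqrt (ln n%:R) / n%:R) ->
  ~ exists Rej : forall n, R -> procedure n, AMO Rej k.
Proof.
move=> hdense [Rej [mRej [eta [eta0 etaC] [hI hII]]]].
have {}hI := limn_esup_near_le (e := 32^-1) hI.
have {hII} : \forall n \near \oo, (ereal_sup
   [set risk_II (Rej n alpha) (k n) (alpha * (1 - eta n)) | alpha in level_range n] <= (32^-1)%:E)%E.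
  apply: limn_esup_near_le; last by rewrite invr_gt0.
  by rewrite (is_cvg_limn_esupE (cvgP _ hII)) (cvg_lim _ hII).
move=> hII.
have hd : \forall n \near \oo, 1 <= (64 * 128)^-1 * `|k n * Num.sqrt (ln n%:R) / n%:R|.
  move/eqoP : hdense => /(_ (64 * 128)^-1) h.
  have := h (ltac:(by rewrite invr_gt0)); apply: filterS => n /=.
  by rewrite normr1.
have he : \forall n \near \oo, eta n <= 2^-1.
  by apply: (cvgr_le _ etaC); rewrite invr_gt0.
have h9 : \forall n \near \oo, (9 <= n)%N by exists 9%N.
have hI' := hI (ltac:(by rewrite invr_gt0)).
have [n [[[[n9 en] dn] In] IIn]] : exists n, (((((9 <= n)%N /\ eta n <= 2^-1) /\
   1 <= (64 * 128)^-1 * `|k n * Num.sqrt (ln n%:R) / n%:R|) /\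
   (ereal_sup [set risk_I (Rej n alpha) (k n) - alpha%:E | alpha in level_range n] <= (32^-1)%:E)%E) /\
   (ereal_sup [set risk_II (Rej n alpha) (k n) (alpha * (1 - eta n)) | alpha in level_range n] <= (32^-1)%:E)%E).
  have := filterI (filterI (filterI (filterI h9 he) hd) hI') hII.
  by case=> N _ hN; exists N; exact: (hN N (leqnn N)).
clear hdense etaC hI hI' hII hd he h9.
have n2 : (2 < n)%N by apply: leq_trans n9.
have n0 : (0 < n)%N by apply: leq_trans n9.
have n0R : 0 < n%:R :> R by rewrite ltr0n.
have /andP[k1 kn] := hk n n2.
have hk' : 0 < k n < n%:R / 2 by rewrite kn andbT; lra.
have {}dn : 64 * 128 <= k n * Num.sqrt (ln n%:R) / n%:R.
  move: dn; rewrite ger0_norm; last first.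
    by rewrite divr_ge0 ?mulr_ge0//; lra.
  by lra.
have lr : level_range n (8^-1 : R).
  apply/andP; split; last by lra.
  by rewrite ltf_pV2 ?posrE// ltr_nat.
have rI : (risk_I (Rej n (8^-1)%R) (k n) <= (5 / 32)%R%:E)%E.
  have : (risk_I (Rej n (8^-1)%R) (k n) - (8^-1)%:E <= (32^-1)%:E)%E.
    by apply: le_trans In; apply: ereal_sup_ubound; exists (8^-1 : R).
  by rewrite leeBlDr// -EFinD => /le_trans; apply; rewrite lee_fin; lra.
pose alpha : R := 8^-1 * (1 - eta n).
have a1 : 16^-1 <= alpha <= 8^-1.
  have en0 := eta0 n.
  by rewrite /alpha; apply/andP; split; lra.
have rII : (risk_II (Rej n (8^-1)%R) (k n) alpha <= (32^-1)%:E)%E.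
  by apply: le_trans IIn; apply: ereal_sup_ubound; exists (8^-1 : R).
clearbody alpha; clear In IIn en; have /andP[a2 a3] := a1.
have an0 : 0 < alpha / n%:R / 2 by rewrite !divr_gt0//; lra.
have [|x x0 xa] := @upper_tail_quantile R (alpha / n%:R / 2).
  rewrite an0/= -[leRHS]mul1r ler_wpM2r// ler_pdivrMr// mul1r.
  have : 1 <= n%:R :> R by rewrite ler1n.
  by lra.
(* Any fixed level is suitable provided that twice the false discovery rate is
   well below 1; with the level 1/8 and slacks 1/32 the bound of
   [mimicking_tradeoff] is 5/16 + 1/32 + 3/64 + 1/2 < 1. *)
have [m0 mx hc hq] := dense_regime_bounds n0 hk' dn a1 xa.
have := @mimicking_tradeoff n (Rej n (8^-1)%R) (k n) alpha _ x (5/32) (32^-1) _ hk' _ m0 mx _ _ _ rI rII.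
have mR : forall S, measurable [set y : n.-tuple R | Rej n 8^-1 y 1 = S].
  by move=> S; apply: mRej => //; rewrite invr_gt0 ltr0n/= invf_lt1// ltr1n.
have al1 : 0 < alpha <= 1.
  by rewrite (lt_le_trans _ a2) ?invr_gt0//= (le_trans a3)// invf_le1// ler1n.
have ux : 2 * upper_tail x <= alpha / n%:R by rewrite xa mulrC divfK.
have r0 : 0 <= 5 / 32 :> R by rewrite divr_ge0.
have e0 : 0 <= 32^-1 :> R by rewrite invr_ge0.
move=> /(_ mR al1 ux r0 e0).
set c := (_ ^-1 * (n%:R * _)) in hc *; set q := (_ ^+ n) in hq *.
by move: hc hq; clear; lra.
Qed.

End lower_bound.

Theorem theorem4p1 (R : realType) (k : nat -> R)
    (hk : forall n, (2 < n)%N -> 1 <= k n < n%:R / 2) :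
  ((fun=> 1 : R) =o_\oo (fun n => k n * Num.sqrt (ln n%:R) / n%:R) ->
     ~ exists Rej : forall n, R -> procedure n, AMO Rej k)
  /\
  ((fun n => k n * Num.sqrt (ln n%:R) / n%:R) =o_\oo (fun=> 1 : R) ->
     AMO (fun n alpha y s => BH alpha y (median y) s) k).
Proof.
split; first exact: no_AMO_dense.
by move=> h; exact: median_BH_AMO.
Qed.
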